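(* Let $X\subset\mathbb P^2$ be a smooth plane curve of degree $d\geq 4$ over $\mathbb C$, and let $g$ be a linear automorphism of $X$. (1) If $\mathrm{ord}(g)=d-1$, then $\sharp\,\mathrm{Fix}(g)\neq 2$ if and only if $X$ has an inner Galois point $p$ such that $g$ is an automorphism belonging to the Galois point $p$. (2) If $\mathrm{ord}(g)=d$, then $\mathrm{Fix}(g)\neq\emptyset$ if and only if $X$ has an outer Galois point $p$ such that $g$ is an automorphism belonging to the Galois point $p$.
   Context: We work over $\mathbb C$; $\mathbb C(Y)$ denotes the function field of an irreducible variety $Y$. For a smooth hypersurface $X\subset\mathbb P^{n+1}$ and a point $p\in\mathbb P^{n+1}$, let $\pi_p:X\dashrightarrow H$ be the projection with center $p$ onto a hyperplane $H\cong\mathbb P^n$ not containing $p$. It induces a field extension $\pi_p^*:\mathbb C(H)\hookrightarrow\mathbb C(X)$; write $K_p$ for the image of $\mathbb C(H)$ (it does not depend on the choice of $H$). One has $[\mathbb C(X):K_p]=d-1$ if $p\in X$ and $d$ if $p\notin X$. The point $p$ is called a Galois point for $X$ if $\mathbb C(X)/K_p$ is a Galois extension; it is an inner Galois point if moreover $p\in X$, and an outer Galois point if moreover $p\notin X$. An automorphism $g$ of $X$ is linear if there is an automorphism $h$ of $\mathbb P^{n+1}$ with $h(X)=X$ and $h|_X=g$. If $p$ is a Galois point of $X$, an automorphism $g$ of $X$ is called an automorphism belonging to the Galois point $p$ if $g$ (through its induced action on $\mathbb C(X)$) generates the Galois group of $\mathbb C(X)/K_p$. For an automorphism $g$ of $X$,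 $\mathrm{ord}(g)$ is its order and $\mathrm{Fix}(g)=\{x\in X\mid g(x)=x\}$. Here $n=1$. *)

(* Defs.v *)
From HB Require Import structures.
From mathcomp Require Import all_boot all_order all_algebra ring.
From mathcomp Require Import boolp classical_sets cardinality reals.
From mathcomp Require Import complex mpoly.

Set Implicit Arguments.
Unset Strict Implicit.
Unset Printing Implicit Defensive.

Import GRing.Theory.
Local Open Scope ring_scope.
Local Open Scope quotient_scope.
Local Open Scope classical_set_scope.

Section FunctionField.
Context (C : fieldType) (n : nat) (F : {mpoly C[n]}).
Implicit Types P Q G H : {mpoly C[n]}.

Definition in_ideal P := exists Q, P = Q * F.

Lemma in_ideal0 : in_ideal 0.
Proof. by exists 0; rewrite mul0r. Qed.

Lemma in_idealD P Q : in_ideal P -> in_ideal Q -> in_ideal (P + Q).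
Proof. by move=> [a ->] [b ->]; exists (a + b); rewrite mulrDl. Qed.

Lemma in_idealN P : in_ideal P -> in_ideal (- P).
Proof. by move=> [a ->]; exists (- a); rewrite mulNr. Qed.

Lemma in_idealMl P Q : in_ideal P -> in_ideal (Q * P).
Proof. by move=> [a ->]; exists (Q * a); rewrite mulrA. Qed.

(* H is a nonzerodivisor modulo F; for irreducible F this just says that H
   does not vanish identically on the hypersurface F = 0. *)
Definition regular_mod H := forall P, in_ideal (H * P) -> in_ideal P.

Lemma regular_mod1 : regular_mod 1.
Proof. by move=> P; rewrite mul1r. Qed.

Lemma regular_modM G H : regular_mod G -> regular_mod H -> regular_mod (G * H).
Proof. by move=> rG rH P; rewrite -mulrA => /rG /rH. Qed.

Definition hfrac_pred (x : {mpoly C[n]} * {mpoly C[n]}) : bool :=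
  `[< (exists m : nat, x.1 \is m.-homog /\ x.2 \is m.-homog) /\
      regular_mod x.2 >].

Record hfrac := Hfrac { hfrac_val : _; _ : hfrac_pred hfrac_val }.
HB.instance Definition _ := [isSub for hfrac_val].
HB.instance Definition _ := [Choice of hfrac by <:].

Definition hnum (x : hfrac) := (hfrac_val x).1.
Definition hden (x : hfrac) := (hfrac_val x).2.

Lemma hden_regular x : regular_mod (hden x).
Proof. by have /asboolP[] := valP x. Qed.

Definition hfrac_eq (x y : hfrac) : bool :=
  `[< in_ideal (hnum x * hden y - hnum y * hden x) >].

Lemma hfrac_eq_refl : reflexive hfrac_eq.
Proof. by move=> x; apply/asboolP; rewrite subrr; exact: in_ideal0. Qed.

Lemma hfrac_eq_sym : ssrbool.symmetric hfrac_eq.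
Proof.
by move=> x y; apply/asboolP/asboolP => /in_idealN; rewrite opprB.
Qed.

Lemma hfrac_eq_trans : transitive hfrac_eq.
Proof.
move=> y x z /asboolP xy /asboolP yz; apply/asboolP.
apply: (@hden_regular y).
have -> : hden y * (hnum x * hden z - hnum z * hden x) =
  hden z * (hnum x * hden y - hnum y * hden x) +
  hden x * (hnum y * hden z - hnum z * hden y) by ring.
by apply: in_idealD; exact: in_idealMl.
Qed.

Canonical hfrac_equiv :=
  EquivRel hfrac_eq hfrac_eq_refl hfrac_eq_sym hfrac_eq_trans.

(* The degree 0 part of the total ring of fractions of the homogeneous
   coordinate ring C[x_0, ..., x_(n-1)] / (F).  It makes sense for every F, and
   it is the function field of the hypersurface F = 0 when F is irreducible. *)
Definition function_field := {eq_quot hfrac_eq}.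
HB.instance Definition _ := Choice.on function_field.
HB.instance Definition _ := EqQuotient.on function_field.

Lemma hfrac1_subproof : hfrac_pred (1, 1).
Proof.
apply/asboolP; split; last exact: regular_mod1.
by exists 0; split; exact: dhomog1.
Qed.

(* The rational function G / H (a junk value if G and H are not homogeneous of
   the same degree or if H is a zero divisor modulo F). *)
Definition hratio G H : function_field :=
  \pi_function_field (insubd (Hfrac hfrac1_subproof) (G, H)).

Lemma hfrac_predP G H m : G \is m.-homog -> H \is m.-homog -> regular_mod H ->
  hfrac_pred (G, H).
Proof. by move=> hG hH rH; apply/asboolP; split=> //; exists m. Qed.

Lemma hratio_surj (x : function_field) :
  exists G H, hfrac_pred (G, H) /\ x = hratio G H.
Proof.
exists (hnum (repr x)), (hden (repr x)).
have e : (hnum (repr x), hden (repr x)) = val (repr x).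
  by rewrite /hnum /hden -surjective_pairing.
by rewrite /hratio e valKd reprK (valP (repr x)).
Qed.

Lemma eq_hratio G H G' H' : hfrac_pred (G, H) -> hfrac_pred (G', H') ->
  hratio G H = hratio G' H' <-> in_ideal (G * H' - G' * H).
Proof.
move=> GH GH'.
have e : (hratio G H == hratio G' H') = `[< in_ideal (G * H' - G' * H) >].
  by rewrite eqmodE /= /hfrac_eq /hnum /hden !insubdK.
by split=> [/eqP|?]; [rewrite e => /asboolP | apply/eqP; rewrite e; apply/asboolP].
Qed.

Definition ffadd (x y : function_field) : function_field :=
  let: (a, b) := (repr x, repr y) in
  hratio (hnum a * hden b + hnum b * hden a) (hden a * hden b).
Definition ffopp (x : function_field) : function_field :=
  hratio (- hnum (repr x)) (hden (repr x)).
Definition ffmul (x y : function_field) : function_field :=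
  let: (a, b) := (repr x, repr y) in hratio (hnum a * hnum b) (hden a * hden b).

Lemma hfrac_predD G H G' H' : hfrac_pred (G, H) -> hfrac_pred (G', H') ->
  hfrac_pred (G * H' + G' * H, H * H').
Proof.
move=> /asboolP[[m /= [hG hH]] rH] /asboolP[[m' /= [hG' hH']] rH'].
apply: (@hfrac_predP _ _ (m + m')); last exact: regular_modM.
  by apply: rpredD; [|rewrite addnC]; exact: dhomogM.
exact: dhomogM.
Qed.

Lemma hfrac_predN G H : hfrac_pred (G, H) -> hfrac_pred (- G, H).
Proof.
move=> /asboolP[[m /= [hG hH]] rH].
by apply: (@hfrac_predP _ _ m); rewrite ?rpredN.
Qed.

Lemma hfrac_predM G H G' H' : hfrac_pred (G, H) -> hfrac_pred (G', H') ->
  hfrac_pred (G * G', H * H').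
Proof.
move=> /asboolP[[m /= [hG hH]] rH] /asboolP[[m' /= [hG' hH']] rH'].
by apply: (@hfrac_predP _ _ (m + m')); [exact: dhomogM..|exact: regular_modM].
Qed.

Lemma repr_hratio G H : hfrac_pred (G, H) ->
  let a := repr (hratio G H) in
  hfrac_pred (hnum a, hden a) /\ in_ideal (hnum a * H - G * hden a).
Proof.
move=> GH a.
have e : (hnum a, hden a) = val a by rewrite /hnum /hden -surjective_pairing.
have va : hfrac_pred (hnum a, hden a) by rewrite e (valP a).
by split=> //; apply/eq_hratio => //; rewrite /hratio e valKd reprK.
Qed.

Lemma ffaddE G H G' H' : hfrac_pred (G, H) -> hfrac_pred (G', H') ->
  ffadd (hratio G H) (hratio G' H') = hratio (G * H' + G' * H) (H * H').
Proof.
move=> v v'; have [va ea] := repr_hratio v; have [vb eb] := repr_hratio v'.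
apply/eq_hratio; [exact: hfrac_predD..|].
set a := repr (hratio G H) in va ea *; set b := repr _ in vb eb *.
have -> : (hnum a * hden b + hnum b * hden a) * (H * H') -
    (G * H' + G' * H) * (hden a * hden b) =
  (hden b * H') * (hnum a * H - G * hden a) +
  (hden a * H) * (hnum b * H' - G' * hden b) by ring.
by apply: in_idealD; exact: in_idealMl.
Qed.

Lemma ffoppE G H : hfrac_pred (G, H) -> ffopp (hratio G H) = hratio (- G) H.
Proof.
move=> v; have [va ea] := repr_hratio v.
apply/eq_hratio; [exact: hfrac_predN..|].
by rewrite !mulNr -opprD; exact: in_idealN.
Qed.

Lemma ffmulE G H G' H' : hfrac_pred (G, H) -> hfrac_pred (G', H') ->
  ffmul (hratio G H) (hratio G' H') = hratio (G * G') (H * H').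
Proof.
move=> v v'; have [va ea] := repr_hratio v; have [vb eb] := repr_hratio v'.
apply/eq_hratio; [exact: hfrac_predM..|].
set a := repr (hratio G H) in va ea *; set b := repr _ in vb eb *.
have -> : hnum a * hnum b * (H * H') - G * G' * (hden a * hden b) =
  (hnum b * H') * (hnum a * H - G * hden a) +
  (G * hden a) * (hnum b * H' - G' * hden b) by ring.
by apply: in_idealD; exact: in_idealMl.
Qed.

Lemma hfrac_pred01 : hfrac_pred (0, 1).
Proof.
by apply: (@hfrac_predP _ _ 0); rewrite ?dhomog0 ?dhomog1//; exact: regular_mod1.
Qed.

Lemma hratio_eq G H G' H' : hfrac_pred (G, H) -> hfrac_pred (G', H') ->
  G * H' - G' * H = 0 -> hratio G H = hratio G' H'.
Proof. by move=> v v' e; apply/eq_hratio; rewrite ?e//; exact: in_ideal0. Qed.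

#[local] Hint Resolve hfrac_pred01 hfrac1_subproof hfrac_predD hfrac_predN
  hfrac_predM : core.

Lemma ffaddA : associative ffadd.
Proof.
move=> x y z; have [G [H [v ->]]] := hratio_surj x.
have [G' [H' [v' ->]]] := hratio_surj y; have [K [L [w ->]]] := hratio_surj z.
by rewrite !ffaddE; auto; apply: hratio_eq; auto; ring.
Qed.

Lemma ffaddC : commutative ffadd.
Proof.
move=> x y; have [G [H [v ->]]] := hratio_surj x.
have [G' [H' [v' ->]]] := hratio_surj y.
by rewrite !ffaddE; auto; apply: hratio_eq; auto; ring.
Qed.

Lemma ffadd0 : left_id (hratio 0 1) ffadd.
Proof.
move=> x; have [G [H [v ->]]] := hratio_surj x.
by rewrite !ffaddE; auto; apply: hratio_eq; auto; ring.
Qed.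

Lemma ffaddN : left_inverse (hratio 0 1) ffopp ffadd.
Proof.
move=> x; have [G [H [v ->]]] := hratio_surj x.
by rewrite ffoppE ?ffaddE; auto; apply: hratio_eq; auto; ring.
Qed.

Lemma ffmulA : associative ffmul.
Proof.
move=> x y z; have [G [H [v ->]]] := hratio_surj x.
have [G' [H' [v' ->]]] := hratio_surj y; have [K [L [w ->]]] := hratio_surj z.
by rewrite !ffmulE; auto; apply: hratio_eq; auto; ring.
Qed.

Lemma ffmulC : commutative ffmul.
Proof.
move=> x y; have [G [H [v ->]]] := hratio_surj x.
have [G' [H' [v' ->]]] := hratio_surj y.
by rewrite !ffmulE; auto; apply: hratio_eq; auto; ring.
Qed.

Lemma ffmul1 : left_id (hratio 1 1) ffmul.
Proof.
move=> x; have [G [H [v ->]]] := hratio_surj x.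
by rewrite !ffmulE; auto; apply: hratio_eq; auto; ring.
Qed.

Lemma ffmulD : left_distributive ffmul ffadd.
Proof.
move=> x y z; have [G [H [v ->]]] := hratio_surj x.
have [G' [H' [v' ->]]] := hratio_surj y; have [K [L [w ->]]] := hratio_surj z.
by rewrite !(ffmulE, ffaddE); auto; apply: hratio_eq; auto; ring.
Qed.

HB.instance Definition _ := GRing.isZmodule.Build function_field
  ffaddA ffaddC ffadd0 ffaddN.
HB.instance Definition _ := GRing.Zmodule_isComPzRing.Build function_field
  ffmulA ffmulC ffmul1 ffmulD.

End FunctionField.

Section Galois.
Context (L : comPzRingType) (K : set L).

Definition is_field := (1 : L) <> 0 /\ forall x : L, x <> 0 -> exists y, x * y = 1.

Definition finite_over := exists (m : nat) (b : 'I_m -> L), forall x : L,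
  exists c : 'I_m -> L, (forall i, K (c i)) /\ x = \sum_i c i * b i.

Definition galois_aut (s : {rmorphism L -> L}) :=
  bijective s /\ forall x, K x -> s x = x.

(* A finite extension L / K is Galois when K is the fixed field of Aut(L / K).
   As L is only typed as a ring, being a field is part of the definition. *)
Definition galois_ext :=
  [/\ is_field, finite_over &
      forall x, (forall s, galois_aut s -> s x = x) <-> K x].

(* Natural powers are enough, the Galois group of a finite extension being
   finite. *)
Definition generates_galois_group (t : L -> L) :=
  exists s : {rmorphism L -> L}, [/\ galois_aut s, s =1 t &
    forall s', galois_aut s' -> exists k, s' =1 iter k s].

End Galois.

Section PlaneCurves.
Context (C : fieldType).
Implicit Types (F G : {mpoly C[3]}) (A : 'M[C]_3) (p U : {vspace 'rV[C]_3}).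

(* Points of the projective plane are the lines U of C^3 (\dim U = 1). *)
Definition zero_locus F : set {vspace 'rV[C]_3} :=
  [set U | \dim U = 1%N /\ forall v : 'rV[C]_3, v \in U -> F.@[v ord0] = 0].

Definition smooth_plane_curve d F := F \is d.-homog /\
  forall v : 'rV[C]_3, v <> 0 -> F.@[v ord0] = 0 ->
    exists i, (F^`M(i)).@[v ord0] <> 0.

(* The projective transformation [v] |-> [v *m A]. *)
Definition proj_act A U := (linfun (mulmxr A) @: U)%VS.

(* A represents the linear automorphism g of the curve F = 0 that it induces by
   restriction. *)
Definition linear_automorphism F A :=
  A \in unitmx /\ proj_act A @` zero_locus F = zero_locus F.

Definition fixed_points F A : set {vspace 'rV[C]_3} :=
  [set U | zero_locus F U /\ proj_act A U = U].

(* g ^ k is the identity on the curve, for g induced by A. *)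
Definition trivial_power F A k :=
  forall U, zero_locus F U -> iter k (proj_act A) U = U.

Definition has_order F A m :=
  [/\ (0 < m)%N, trivial_power F A m &
      forall k, (0 < k < m)%N -> ~ trivial_power F A k].

(* The polynomial function v |-> G (v *m A). *)
Definition mpoly_mx G A : {mpoly C[3]} :=
  G \mPo [tuple \sum_j A j i *: 'X_j | i < 3].

Lemma mpoly_mxE G A (v : 'rV[C]_3) :
  (mpoly_mx G A).@[v ord0] = G.@[(v *m A) ord0].
Proof.
rewrite /mpoly_mx comp_mpoly_meval; apply: meval_eq => i.
rewrite tnth_map tnth_ord_tuple mxE raddf_sum /=; apply: eq_bigr => j _.
by rewrite mevalZ mevalXU mulrC.
Qed.

(* phi |-> phi \o g for a linear automorphism g; the result does not depend on
   the representative of phi. *)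
Definition pullback F A (phi : function_field F) : function_field F :=
  hratio F (mpoly_mx (hnum (repr phi)) A) (mpoly_mx (hden (repr phi)) A).
Arguments pullback F A phi : clear implicits.

(* The projection with center [w] onto the line v *m h = 0, for w *m h <> 0. *)
Definition center_proj_mx (w : 'rV[C]_3) (h : 'cV[C]_3) : 'M[C]_3 :=
  ((w *m h) ord0 ord0)%:M - h *m w.

Lemma center_proj_mxE w h (v : 'rV[C]_3) :
  v *m center_proj_mx w h =
  (w *m h) ord0 ord0 *: v - (v *m h) ord0 ord0 *: w.
Proof.
rewrite mulmxBr mul_mx_scalar mulmxA.
by rewrite [in LHS](mx11_scalar (v *m h)) mul_scalar_mx.
Qed.

(* K_p, the pullback under the projection with center p of the function field
   of a line H not through p; all choices of H give the same subset. *)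
Definition proj_field F p : set (function_field F) :=
  [set phi | exists (h : 'cV[C]_3) (m : nat) G1 G2,
    let pi_p := center_proj_mx (vpick p) h in
    [/\ vpick p *m h <> 0, G1 \is m.-homog, G2 \is m.-homog,
        regular_mod F (mpoly_mx G2 pi_p) &
        phi = hratio F (mpoly_mx G1 pi_p) (mpoly_mx G2 pi_p)]].
Arguments proj_field F p phi : clear implicits.

Definition galois_point F p := \dim p = 1%N /\ galois_ext (proj_field F p).

Definition inner_galois_point F p := galois_point F p /\ zero_locus F p.

Definition outer_galois_point F p := galois_point F p /\ ~ zero_locus F p.

Definition belongs_to F A p :=
  generates_galois_group (proj_field F p) (pullback F A).

End PlaneCurves.

Arguments pullback {C} F A phi.
Arguments proj_field {C} F p phi.

(* Main.v *)
Require Import Defs.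
From HB Require Import structures.
From mathcomp Require Import all_boot all_order all_algebra ring.
From mathcomp Require Import boolp classical_sets cardinality reals.
From mathcomp Require Import complex separable mpoly.

Set Implicit Arguments.
Unset Strict Implicit.
Unset Printing Implicit Defensive.

Import Order.TTheory GRing.Theory Num.Theory.
Local Open Scope ring_scope.

(* Let A represent g.  On a line transversal to the smooth curve F = 0 the curve
   has d distinct points, which determine F up to a constant; hence F o A is a
   multiple of F, and a power of A fixing the curve pointwise is scalar, so that
   A is diagonalizable.  Smoothness at an eigenvector e_i relates the factor of
   F o A = l F to the eigenvalues: l = a_i^d if F(e_i) <> 0, and
   l = a_i^(d-1) a_j for some j <> i otherwise.  If the a_i are distinct, this
   leaves exactly two fixed points when g has order d - 1 and none when g has
   order d, and g belongs to no Galois point, because A then does not preserve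
   every line through a point.  Otherwise g is a homology and its equation is
   F = G(x, y) + z^m L(x, y), m being the order of g.  Eisenstein's criterion at a
   simple zero of G makes the ideal (F) prime; the function field is generated
   over the fixed field of g by t = z / x with t^m invariant, and the fixed field
   is that of the projection from the center of the homology, so Kummer theory
   shows that the center is a Galois point to which g belongs. *)

(** * Polynomials and evaluation *)

(** The definitions carry no irreducibility: [function_field F] comes only as a ring, so that it is
    a field belongs to what must be shown for a Galois point. This is done only for homologies,
    whose equation is simple enough for Eisenstein. The case of distinct eigenvalues does without
    it: belonging to p makes g fix the quotients of linear forms vanishing at p, each such identity
    is a form of degree 2 in the ideal (F), and 2 < d makes it an identity of polynomials.
    Eisenstein is applied over a polynomial ring in two variables, where division with remainder is
    only pseudo-division: it multiplies by powers of the leading coefficient L. These are removed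
    because L, of degree d - m at most 1, is a nonzerodivisor modulo F, and this can be proved
    beforehand: a smooth curve of degree at least 2 contains no line. Both orders are treated at
    once, as m with m <= d <= m + 1. *)

Local Notation i0 := (@Ordinal 3 0 isT).
Local Notation i1 := (@Ordinal 3 1 isT).
Local Notation i2 := (@Ordinal 3 2 isT).

Lemma ord3P (P : 'I_3 -> Prop) : P i0 -> P i1 -> P i2 -> forall i, P i.
Proof.
by move=> P0 P1 P2 [[|[|[|//]]] lt]; rewrite (bool_irrelevance lt isT).
Qed.

Lemma big_ord3 (R : Type) (idx : R) (op : Monoid.law idx) (f : 'I_3 -> R) :
  \big[op/idx]_(i < 3) f i = op (f i0) (op (f i1) (f i2)).
Proof.
rewrite !big_ord_recl big_ord0 Monoid.mulm1.
by congr (op (f _) (op (f _) (f _))); apply: ord_inj.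
Qed.

(** Rotation of a cyclic index; it gives the invariance of norms and averages over the powers of A,
    and the shift rule for Fourier sums. *)
Lemma big_ord_shift (R : Type) (idx : R) (op : Monoid.com_law idx) n (f : nat -> R) :
  f n = f 0%N -> \big[op/idx]_(j < n) f j.+1 = \big[op/idx]_(j < n) f j.
Proof.
case: n => [|n] fn; first by rewrite !big_ord0.
rewrite big_ord_recr [RHS]big_ord_recl /= fn Monoid.mulmC.
by congr (op _ _); apply: eq_bigr => j _.
Qed.

Lemma mpoly_ring_ind (R : comNzRingType) n (P : {mpoly R[n]} -> Prop) :
  (forall c, P c%:MP) -> (forall i, P 'X_i) ->
  (forall p q, P p -> P q -> P (p + q)) ->
  (forall p q, P p -> P q -> P (p * q)) -> forall p, P p.
Proof.
move=> PC PX PD PM; elim/mpolyind => [|c m p _ _ Pp].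
  by rewrite -(mpolyC0 n); exact: PC.
apply: PD => //; rewrite -mul_mpolyC; apply: (PM) => //.
rewrite mpolyXE_id; elim/big_ind: _ => // [|i _]; first by rewrite -mpolyC1.
by elim: (m i) => [|k Pk]; rewrite ?expr0 -?mpolyC1 // exprS; exact: PM.
Qed.

Section PolyVanishing.
Variable C : numDomainType.

Lemma poly_vanish (p : {poly C}) : (forall x, p.[x] = 0) -> p = 0.
Proof.
move=> p0; apply/eqP; apply: contraT => pn0.
have := @max_poly_roots _ p [seq i%:R | i <- iota 0 (size p)] pn0.
rewrite size_map size_iota ltnn; apply.
  by apply/allP => x _; rewrite /root p0.
by rewrite map_inj_uniq ?iota_uniq// => i j /eqP; rewrite eqr_nat => /eqP.
Qed.

Lemma poly_vanish_off (p r : {poly C}) : r != 0 ->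
  (forall x, r.[x] != 0 -> p.[x] = 0) -> p = 0.
Proof.
move=> rn0 p0; have /eqP : p * r = 0.
  apply: poly_vanish => x; rewrite hornerM.
  by have [->|/p0 ->] := eqVneq r.[x] 0; rewrite ?mulr0 ?mul0r.
by rewrite mulf_eq0 (negPf rn0) orbF => /eqP.
Qed.

Lemma poly_nonroot (r : {poly C}) : r != 0 -> exists x, r.[x] != 0.
Proof.
move=> rn0; have [//|none] := pselect (exists x, r.[x] != 0).
case/eqP: rn0; apply: poly_vanish => x; apply/eqP; apply: contraT => rx.
by case: none; exists x.
Qed.

End PolyVanishing.

Section Nested.
Variable C : numFieldType.
Local Notation T := {poly {poly {poly C}}}.

(** The nesting is dictated by Eisenstein's criterion: ['X_i2] is outermost, being the main
    variable; ['X_i0] comes next, being the prime of the coefficient ring at which one reduces;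
    ['X_i1] is innermost. *)
Definition nest_var (i : 'I_3) : T :=
  tnth [tuple ('X)%:P; ('X)%:P%:P; 'X] i.

Definition nest : {mpoly C[3]} -> T :=
  mmap (polyC \o (polyC \o polyC)) nest_var.
HB.instance Definition _ := GRing.RMorphism.on nest.

Let comm1 : commr_rmorph (@mpolyC 3 C) 'X_i1.
Proof. by move=> c; exact: mulrC. Qed.
Definition unnest1 : {poly C} -> {mpoly C[3]} := horner_morph comm1.
HB.instance Definition _ := GRing.RMorphism.on unnest1.

Let comm2 : commr_rmorph unnest1 'X_i0.
Proof. by move=> c; exact: mulrC. Qed.
Definition unnest2 : {poly {poly C}} -> {mpoly C[3]} := horner_morph comm2.
HB.instance Definition _ := GRing.RMorphism.on unnest2.

Let comm3 : commr_rmorph unnest2 'X_i2.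
Proof. by move=> c; exact: mulrC. Qed.
Definition unnest : T -> {mpoly C[3]} := horner_morph comm3.
HB.instance Definition _ := GRing.RMorphism.on unnest.

Lemma nestD P Q : nest (P + Q) = nest P + nest Q.
Proof. exact: mmapD. Qed.

Lemma nestM P Q : nest (P * Q) = nest P * nest Q.
Proof. exact: (rmorphM nest). Qed.

Lemma nestX P k : nest (P ^+ k) = nest P ^+ k.
Proof. exact: (rmorphXn nest). Qed.

Lemma unnestD p q : unnest (p + q) = unnest p + unnest q.
Proof. exact: (rmorphD unnest). Qed.

Lemma unnestM p q : unnest (p * q) = unnest p * unnest q.
Proof. exact: (rmorphM unnest). Qed.

Lemma unnestX p k : unnest (p ^+ k) = unnest p ^+ k.
Proof. exact: (rmorphXn unnest). Qed.

Lemma nestK : cancel nest unnest.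
Proof.
elim/mpoly_ring_ind => [c|i|p q|p q].
- rewrite /nest mmapC /= /unnest /horner_morph map_polyC hornerC.
  rewrite /= /unnest2 /horner_morph map_polyC hornerC.
  by rewrite /= /unnest1 /horner_morph map_polyC hornerC.
- rewrite /nest mmapX mmap1U; move: i; apply: ord3P;
    rewrite /nest_var (tnth_nth 0) /= /unnest /horner_morph.
  + by rewrite map_polyC hornerC /= /unnest2 /horner_morph map_polyX hornerX.
  + rewrite map_polyC hornerC /= /unnest2 /horner_morph map_polyC hornerC /=.
    by rewrite /unnest1 /horner_morph map_polyX hornerX.
  + by rewrite map_polyX hornerX.
- by rewrite nestD unnestD => -> ->.
- by rewrite nestM unnestM => -> ->.
Qed.

Lemma unnest_nest_rel L P F q k : nest L ^+ k * nest P = q * nest F ->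
  L ^+ k * P = unnest q * F.
Proof.
by move=> E; have := unnestM q (nest F); rewrite -E unnestM unnestX !nestK.
Qed.

Lemma horner_nest P (v : 'rV[C]_3) :
  (nest P).[(v ord0 i2)%:P%:P].[(v ord0 i0)%:P].[v ord0 i1] = P.@[v ord0].
Proof.
elim/mpoly_ring_ind: P => [c|i|p q|p q].
- by rewrite /nest mmapC /= !hornerC mevalC.
- rewrite /nest mmapX mmap1U mevalXU; move: i; apply: ord3P;
    by rewrite /nest_var (tnth_nth 0) /= !(hornerC,hornerX).
- by rewrite nestD mevalD => <- <-; rewrite -!hornerD.
- by rewrite nestM mevalM => <- <-; rewrite -!hornerM.
Qed.

(** One nested variable at a time: a nonzero polynomial over a domain of characteristic 0 cannot
    have all natural numbers as roots. Identities between substituted polynomials are checked on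
    values through this lemma. *)
Lemma mpoly_ext (P Q : {mpoly C[3]}) :
  (forall v : 'rV[C]_3, P.@[v ord0] = Q.@[v ord0]) -> P = Q.
Proof.
move=> PQ; apply/eqP; rewrite -subr_eq0; apply/eqP.
rewrite -[_ - _]nestK; set p := nest _; suff -> : p = 0 by rewrite rmorph0.
have p0 x y z : p.[z%:P%:P].[x%:P].[y] = 0.
  pose v : 'rV_3 := \row_i tnth [tuple x; y; z] i.
  have := horner_nest (P - Q) v; rewrite mevalB PQ subrr.
  by rewrite !mxE !(tnth_nth 0).
have vanish2 (q : {poly {poly C}}) : (forall x y, q.[x%:P].[y] = 0) -> q = 0.
  move=> q0; apply/eqP; apply: contraT => qn0.
  have qx x : q.[x%:P] = 0 by apply: poly_vanish => y; exact: q0.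
  have := @max_poly_roots _ q [seq (i%:R)%:P | i <- iota 0 (size q)] qn0.
  rewrite size_map size_iota ltnn; apply.
    by apply/allP => _ /mapP[i _ ->]; rewrite /root qx.
  rewrite map_inj_uniq ?iota_uniq// => i j /polyC_inj/eqP.
  by rewrite eqr_nat => /eqP.
apply/eqP; apply: contraT => pn0.
have pz z : p.[z%:P%:P] = 0 by apply: vanish2 => x y; exact: p0.
have := @max_poly_roots _ p [seq (i%:R)%:P%:P | i <- iota 0 (size p)] pn0.
rewrite size_map size_iota ltnn; apply.
  by apply/allP => _ /mapP[i _ ->]; rewrite /root pz.
rewrite map_inj_uniq ?iota_uniq// => i j /polyC_inj/polyC_inj/eqP.
by rewrite eqr_nat => /eqP.
Qed.

End Nested.

(** * Restriction to lines *)

Section LinePoly.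
Variable C : numFieldType.
Implicit Types (F : {mpoly C[3]}) (p v w : 'rV[C]_3).

Lemma homog_scale d F s v : F \is d.-homog ->
  F.@[(s *: v) ord0] = s ^+ d * F.@[v ord0].
Proof.
move=> /dhomogP hF; rewrite !mevalE mulr_sumr; apply: eq_big_seq => m mF.
rewrite mulrCA -(hF _ mF) /= mdegE; congr (_ * _).
by rewrite -prodrXr -big_split; apply: eq_bigr => i _; rewrite mxE exprMn.
Qed.

Lemma homog_eval0 d F : F \is d.-homog -> (0 < d)%N -> F.@[(0 : 'rV[C]_3) ord0] = 0.
Proof.
by move=> hF d0; rewrite -[0](scale0r 0) (homog_scale _ _ hF) expr0n gtn_eqF ?mul0r.
Qed.

Definition line_poly p w : {mpoly C[3]} -> {poly C} :=
  mmap polyC (fun i => (p ord0 i)%:P + w ord0 i *: 'X).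
HB.instance Definition _ p w := GRing.RMorphism.on (line_poly p w).

Lemma line_polyC c p w : line_poly p w c%:MP = c%:P.
Proof. by rewrite /line_poly mmapC. Qed.

Lemma line_polyX i p w :
  line_poly p w 'X_i = (p ord0 i)%:P + w ord0 i *: 'X.
Proof. by rewrite /line_poly mmapX mmap1U. Qed.

Lemma line_polyD F G p w :
  line_poly p w (F + G) = line_poly p w F + line_poly p w G.
Proof. exact: raddfD (line_poly p w) F G. Qed.

Lemma line_polyM F G p w :
  line_poly p w (F * G) = line_poly p w F * line_poly p w G.
Proof. exact: (rmorphM (line_poly p w)). Qed.

Lemma horner_line F p w s :
  (line_poly p w F).[s] = F.@[(p + s *: w) ord0].
Proof.
elim/mpoly_ring_ind: F => [c|i|F G|F G].
- by rewrite line_polyC hornerC mevalC.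
- by rewrite line_polyX !hornerE mevalXU !mxE mulrC.
- by rewrite line_polyD hornerD mevalD => -> ->.
- by rewrite line_polyM hornerM mevalM => -> ->.
Qed.

Lemma line_poly_coef0 F p w : (line_poly p w F)`_0 = F.@[p ord0].
Proof. by rewrite -horner_coef0 horner_line scale0r addr0. Qed.

Definition dir_deriv F p w := \sum_i w ord0 i * (F^`M(i)).@[p ord0].

Lemma line_poly_deriv F p w s :
  (line_poly p w F)^`().[s] = dir_deriv F (p + s *: w) w.
Proof.
elim/mpoly_ring_ind: F => [c|i|F G IF IG|F G IF IG].
- rewrite line_polyC derivC horner0 /dir_deriv big1// => i _.
  by rewrite mderivC meval0 mulr0.
- rewrite line_polyX derivD derivC derivZ derivX !hornerE /dir_deriv.
  rewrite (bigD1 i) //= big1 => [|j ji]; rewrite mderivX mnm1E.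
    by rewrite eqxx -[X in (X - _)%MM]add0m addmK mpolyX0 mevalZ meval1 !mulr1 addr0.
  by rewrite eq_sym (negPf ji) mevalZ mul0r mulr0.
- rewrite line_polyD derivD hornerD IF IG /dir_deriv -big_split.
  by apply: eq_bigr => i _; rewrite mderivD mevalD mulrDr.
- rewrite line_polyM derivM !hornerE IF IG !horner_line /dir_deriv.
  rewrite mulr_suml mulr_sumr -big_split.
  by apply: eq_bigr => i _; rewrite mderivM mevalD !mevalM /=; ring.
Qed.

Lemma line_poly_coef1 F p w : (line_poly p w F)`_1 = dir_deriv F p w.
Proof.
have := line_poly_deriv F p w 0; rewrite scale0r addr0 => <-.
by rewrite horner_coef0 coef_deriv mulr1n.
Qed.

Lemma dir_derivD F p v w : dir_deriv F p (v + w) = dir_deriv F p v + dir_deriv F p w.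
Proof.
by rewrite /dir_deriv -big_split; apply: eq_bigr => i _; rewrite mxE mulrDl.
Qed.

Lemma dir_derivZ F p a w : dir_deriv F p (a *: w) = a * dir_deriv F p w.
Proof.
by rewrite /dir_deriv mulr_sumr; apply: eq_bigr => i _; rewrite mxE mulrA.
Qed.

Lemma dir_deriv_delta F p i : dir_deriv F p (delta_mx ord0 i) = (F^`M(i)).@[p ord0].
Proof.
rewrite /dir_deriv (bigD1 i) //= mxE !eqxx mul1r big1 ?addr0// => j ji.
by rewrite mxE (negPf ji) mul0r.
Qed.

Lemma line_poly_homog d F p w : F \is d.-homog ->
  (size (line_poly p w F) <= d.+1)%N /\ (line_poly p w F)`_d = F.@[w ord0].
Proof.
move=> /dhomogP hF.
(* The coefficient c may be 0: bounding the degree instead of fixing it makes [top] multiplicative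
   without any condition on leading coefficients. *)
pose top k r c := (size (r : {poly C}) <= k.+1)%N /\ r`_k = c :> C.
have topM k r c k' r' c' :
  top k r c -> top k' r' c' -> top (k + k')%N (r * r') (c * c').
  move=> [sr rc] [sr' rc']; split.
    apply: leq_trans (size_polyMleq _ _) _.
    by rewrite -subn1 leq_subLR add1n -addnS -addSn leq_add.
  rewrite coefM (bigD1 (Ordinal (leq_addr k' k : k < (k + k').+1)%N)) //=.
  rewrite addKn rc rc' big1 ?addr0// => j jk.
  have [jltk|kltj|jek] := ltngtP j k; last by case/eqP: jk; apply: val_inj.
    rewrite [X in _ * X]nth_default ?mulr0// (leq_trans sr')//.
    by rewrite ltn_subRL ltn_add2r.
  by rewrite nth_default ?mul0r// (leq_trans sr).
have topX k r c n : top k r c -> top (n * k)%N (r ^+ n) (c ^+ n).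
  move=> t; elim: n => [|n IH]; last by rewrite mulSn !exprS; exact: topM.
  by rewrite !expr0; split; rewrite ?size_poly1 ?coef1.
have topm m : top (mdeg m)
    (mmap1 (fun i => (p ord0 i)%:P + w ord0 i *: 'X) m)
    (\prod_i w ord0 i ^+ m i).
  rewrite mdegE /mmap1; elim/big_ind3: _ => [||i _].
  - by split; rewrite ?size_poly1 ?coef1.
  - by move=> k r c k' r' c'; exact: topM.
  - rewrite -[X in top X](muln1 (m i)); apply: topX; split.
      rewrite (leq_trans (size_polyD _ _))// geq_max.
      rewrite (leq_trans (size_polyC_leq1 _))//=.
      by rewrite (leq_trans (size_scale_leq _ _))// size_polyX.
    by rewrite coefD coefC coefZ coefX /= mulr1 add0r.
rewrite /line_poly /mmap mevalE.
have : top d (\sum_(m <- msupp F) (F@_m)%:P *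
    mmap1 (fun i => (p ord0 i)%:P + w ord0 i *: 'X) m)
    (\sum_(m <- msupp F) F@_m * \prod_i w ord0 i ^+ m i); last by case.
rewrite big_seq [X in top d _ X]big_seq; elim/big_ind2: _ => [||m mF].
- by split; rewrite ?size_poly0 ?coef0.
- move=> r c r' c' [sr <-] [sr' <-]; split; last by rewrite coefD.
  by rewrite (leq_trans (size_polyD _ _))// geq_max sr.
- have [s e] := topm m; rewrite -(hF m mF) mul_polyC; split.
    by rewrite (leq_trans (size_scale_leq _ _)).
  by rewrite coefZ e.
Qed.

(** Euler's relation at a zero of F: F vanishes at every multiple of p, hence along p + s p. *)
Lemma euler_zero d F p : F \is d.-homog -> F.@[p ord0] = 0 -> dir_deriv F p p = 0.
Proof.
move=> hF Fp; have := line_poly_deriv F p p 0; rewrite scale0r addr0 => <-.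
suff -> : line_poly p p F = 0 by rewrite deriv0 horner0.
apply: poly_vanish => s.
by rewrite horner_line -{1}[p]scale1r -scalerDl (homog_scale _ _ hF) Fp mulr0.
Qed.

Lemma smooth_dir d F p : smooth_plane_curve d F -> p != 0 -> F.@[p ord0] = 0 ->
  exists w, dir_deriv F p w != 0.
Proof.
move=> [_ sm] /eqP pn0 Fp; have [i Fi] := sm p pn0 Fp.
by exists (delta_mx ord0 i); rewrite dir_deriv_delta; apply/eqP.
Qed.

End LinePoly.

(** * Lines and smooth curves *)

Section Basis3.
Variable C : fieldType.
Implicit Types (v w : 'rV[C]_3).

Definition free3 v0 v1 v2 := forall a b c,
  a *: v0 + b *: v1 + c *: v2 = 0 -> [/\ a = 0, b = 0 & c = 0].

Definition mat3 v0 v1 v2 : 'M[C]_3 :=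
  \matrix_i tnth [tuple v0; v1; v2] i.

Lemma row_mat3 v0 v1 v2 : 
  [/\ row i0 (mat3 v0 v1 v2) = v0, row i1 (mat3 v0 v1 v2) = v1 &
      row i2 (mat3 v0 v1 v2) = v2].
Proof. by split; rewrite rowK. Qed.

Lemma mul_mat3 v0 v1 v2 (u : 'rV[C]_3) :
  u *m mat3 v0 v1 v2 = u ord0 i0 *: v0 + u ord0 i1 *: v1 + u ord0 i2 *: v2.
Proof.
by rewrite mulmx_sum_row big_ord3 /=; have [-> -> ->] := row_mat3 v0 v1 v2;
  rewrite addrA.
Qed.

Lemma free3_unit v0 v1 v2 : free3 v0 v1 v2 <-> mat3 v0 v1 v2 \in unitmx.
Proof.
split=> [fr|un a b c abc0].
  rewrite -row_free_unit -kermx_eq0; apply/eqP/row_matrixP => i; rewrite row0.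
  have : row i (kermx (mat3 v0 v1 v2)) *m mat3 v0 v1 v2 = 0.
    by rewrite -row_mul mulmx_ker row0.
  rewrite mul_mat3 => /fr[r0 r1 r2].
  by apply/rowP; apply: ord3P; rewrite [RHS]mxE.
pose u : 'rV[C]_3 := \row_i tnth [tuple a; b; c] i.
have : u *m mat3 v0 v1 v2 = 0 by rewrite mul_mat3 !mxE !(tnth_nth 0).
move=> /(canRL (mulmxK un)); rewrite mul0mx => u0.
split; [have := congr1 (fun m : 'rV[C]_3 => m ord0 i0) u0
       |have := congr1 (fun m : 'rV[C]_3 => m ord0 i1) u0
       |have := congr1 (fun m : 'rV[C]_3 => m ord0 i2) u0];
  by rewrite !mxE !(tnth_nth 0).
Qed.

Lemma free3_span v0 v1 v2 v : free3 v0 v1 v2 ->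
  exists a b c, v = a *: v0 + b *: v1 + c *: v2.
Proof.
move=> /free3_unit un; rewrite -(mulmxKV un v) mul_mat3.
by do 3!eexists.
Qed.

Lemma free3_rows (e : 'M[C]_3) : e \in unitmx ->
  free3 (row i0 e) (row i1 e) (row i2 e).
Proof.
move=> un; apply/free3_unit; suff -> : mat3 (row i0 e) (row i1 e) (row i2 e) = e by [].
by apply/row_matrixP; apply: ord3P; rewrite rowK.
Qed.

Lemma free3_rot v0 v1 v2 : free3 v0 v1 v2 -> free3 v1 v2 v0.
Proof. by move=> fr a b c; rewrite addrC addrA => /fr[]. Qed.

Lemma free3_swap v0 v1 v2 : free3 v0 v1 v2 -> free3 v1 v0 v2.
Proof. by move=> fr a b c; rewrite [a *: _ + _]addrC => /fr[]. Qed.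

Lemma free3_comb v0 v1 v2 a b c : free3 v0 v1 v2 ->
  (a != 0) || (b != 0) || (c != 0) -> a *: v0 + b *: v1 + c *: v2 != 0.
Proof.
by move=> fr; apply: contraTneq => /fr[-> -> ->]; rewrite eqxx.
Qed.

Lemma free3_neq0 v0 v1 v2 : free3 v0 v1 v2 -> v0 != 0.
Proof.
move=> fr; have := @free3_comb v0 v1 v2 1 0 0 fr.
by rewrite scale1r !scale0r !addr0 oner_eq0; apply.
Qed.

Lemma free3_complete v : v != 0 -> exists v1 v2, free3 v v1 v2.
Proof.
move=> /eqP/rowP vn0.
have [i vi] : exists i, v ord0 i != 0.
  have [//|no] := pselect (exists i, v ord0 i != 0).
  case: vn0 => i; rewrite mxE; apply/eqP; apply: contraT => vi.
  by case: no; exists i.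
exists (delta_mx ord0 (lift i ord0)), (delta_mx ord0 (lift i (lift ord0 ord0))).
move=> a b c /rowP abc.
have ne1 : (i == lift i ord0) = false by rewrite eq_liftF.
have ne2 : (i == lift i (lift ord0 ord0)) = false by rewrite eq_liftF.
have a0 : a = 0.
  have := abc i; rewrite !mxE ne1 ne2 andbF !mulr0 !addr0 => /eqP.
  by rewrite mulf_eq0 (negPf vi) orbF => /eqP.
have := abc (lift i ord0); have := abc (lift i (lift ord0 ord0)).
rewrite a0 !mxE !eqxx ![_ == lift i _](inj_eq lift_inj) /=.
by rewrite !mul0r !mulr0 !mulr1 !add0r ?addr0 => -> ->.
Qed.

End Basis3.

Section Lines.
Variable C : numClosedFieldType.
Implicit Types (F H : {mpoly C[3]}) (p v w : 'rV[C]_3).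

Lemma homog_binary_zero d H v w : (0 < d)%N -> H \is d.-homog ->
  exists a b, ((a != 0) || (b != 0)) /\ H.@[(a *: v + b *: w) ord0] = 0.
Proof.
move=> d0 hH; have [Hw|Hw] := eqVneq (H.@[w ord0]) 0.
  by exists 0, 1; rewrite oner_eq0 orbT scale0r add0r scale1r.
have [sz cd] := line_poly_homog v w hH.
have /closed_rootP[t] : size (line_poly v w H) != 1%N.
  apply: contra Hw => /eqP sz1; rewrite -cd.
  by rewrite nth_default// sz1.
rewrite /root horner_line => /eqP Ht; exists 1, t.
by rewrite oner_eq0 scale1r.
Qed.

Lemma dhomog_mderiv d F i : F \is d.-homog -> F^`M(i) \is d.-1.-homog.
Proof.
move=> /dhomogP hF; apply/dhomogP => m; rewrite mcoeff_msupp mcoeff_deriv => mF.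
have : (m + U_(i))%MM \in msupp F.
  by rewrite mcoeff_msupp; apply: contra mF => /eqP ->; rewrite mul0rn.
by move=> /hF /= <-; rewrite mdegD mdeg1 addn1.
Qed.

(** If F vanished on the line spanned by v and w, its derivatives along v and w would vanish there
    too. The derivative along u is a form of degree d - 1 > 0 and has a zero on the line, which
    would be a singular point. *)
Lemma smooth_line_nonzero d F v w u : (1 < d)%N -> smooth_plane_curve d F ->
  free3 v w u -> exists a b, F.@[(a *: v + b *: w) ord0] != 0.
Proof.
move=> d1 sm fr; have [hF _] := sm.
have [//|none] := pselect (exists a b, F.@[(a *: v + b *: w) ord0] != 0).
have F0 a b : F.@[(a *: v + b *: w) ord0] = 0.
  by apply/eqP; apply: contraT => n0; case: none; exists a, b.
pose H := \sum_i u ord0 i *: F^`M(i).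
have HE p : H.@[p ord0] = dir_deriv F p u.
  by rewrite /H raddf_sum; apply: eq_bigr => i _; rewrite /= mevalZ.
have hH : H \is d.-1.-homog.
  by apply: rpred_sum => i _; apply: rpredZ; apply: dhomog_mderiv.
have d10 : (0 < d.-1)%N by case: (d) d1 => [|[]].
have [a [b [ab0]]] := homog_binary_zero v w d10 hH; rewrite HE => Du.
set p := a *: v + b *: w in Du.
have pn0 : p != 0.
  have := @free3_comb _ _ _ _ a b 0 fr; rewrite scale0r addr0; apply.
  by rewrite eqxx orbF.
have [x /eqP[]] := smooth_dir sm pn0 (F0 a b).
have [x0 [x1 [x2 ->]]] := free3_span x fr.
have Dv a' b' : dir_deriv F p (a' *: v + b' *: w) = 0.
  rewrite -line_poly_coef1; suff -> : line_poly p (a' *: v + b' *: w) F = 0.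
    by rewrite coef0.
  apply: poly_vanish => t; rewrite horner_line /p scalerDr addrACA !scalerA.
  by rewrite -!scalerDl F0.
by rewrite dir_derivD Dv dir_derivZ Du mulr0 addr0.
Qed.

Lemma char0_deriv_neq0 (u : {poly {poly C}}) : (1 < size u)%N -> u^`() != 0.
Proof.
move=> su; apply/eqP => /polyP/(_ (size u).-2); rewrite coef_deriv coef0.
rewrite prednK; last by case: (size u) su => [|[]].
move/eqP; rewrite -scaler_nat scaler_eq0 -[_`__]/(lead_coef u).
rewrite pnatr_eq0 lead_coef_eq0 -size_poly_eq0.
by case: (size u) su => [|[]].
Qed.

(** The lines through q are parametrized by b. The restriction of F to the generic one is
    squarefree, since a square factor would be a component of singular points; r then plays the role
    of the discriminant. *)
Lemma smooth_transversal d F v0 v1 q : (0 < d)%N -> smooth_plane_curve d F ->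
  free3 v0 v1 q -> F.@[q ord0] != 0 ->
  exists2 r : {poly C}, r != 0 &
    forall b, r.[b] != 0 -> separable_poly (line_poly (v0 + b *: v1) q F).
Proof.
move=> d0 sm fr Fq; have [hF _] := sm.
(* F at v0 + b v1 + t q, with b the inner variable and t the outer one. *)
pose f : {poly {poly C}} := mmap (polyC \o polyC) (fun i =>
  ((v0 ord0 i)%:P + v1 ord0 i *: 'X)%:P + (q ord0 i)%:P *: 'X) F.
have fx b : map_poly (horner_eval b) f = line_poly (v0 + b *: v1) q F.
  rewrite /f; elim/mpoly_ring_ind: F {f hF sm Fq} => [c|i|G H|G H].
  - by rewrite line_polyC mmapC /= map_polyC /= /horner_eval hornerC.
  - rewrite line_polyX mmapX mmap1U rmorphD /= map_polyC map_polyZ map_polyX /=.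
    by rewrite /horner_eval !hornerE !mxE mulrC.
  - by rewrite !rmorphD /= => -> ->.
  - by rewrite !rmorphM /= => -> ->.
have ft t : f.[t%:P] = line_poly (v0 + t *: q) v1 F.
  rewrite /f; elim/mpoly_ring_ind: F {f hF sm Fq fx} => [c|i|G H|G H].
  - by rewrite line_polyC mmapC /= hornerC.
  - rewrite line_polyX mmapX mmap1U !hornerE !mxE polyCD polyCM -addrA.
    by rewrite [RHS]addrAC addrA [(q _ _)%:P * _]mulrC.
  - by rewrite !rmorphD hornerD /= => -> ->.
  - by rewrite !rmorphM hornerM /= => -> ->.
have /Bezout_coprimepP[[g h] /=] : coprimep f f^`().
  have : separable_poly f.
    apply/separable_polyP; split; last by move=> u _; exact: char0_deriv_neq0.
    apply/poly_square_freeP => A sA; apply/negP.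
    move=> /Pdiv.Idomain.dvdpP[[c B] /= cn0 cf].
    have fn0 : f != 0.
      apply: contra Fq => /eqP f0.
      have [_ <-] := line_poly_homog (v0 + 0 *: v1) q hF.
      by rewrite -fx f0 rmorph0 coef0.
    have An0 : A != 0.
      apply: contraNneq fn0 => A0; move/eqP: cf.
      by rewrite A0 expr2 !mulr0 scale_poly_eq0 (negPf cn0).
    (* For such b the specialization of A keeps its positive degree, hence has a root t, and the
       factor c stays invertible. *)
    have [b] : exists b, (c * lead_coef A).[b] != 0.
      by apply: poly_nonroot; rewrite mulf_neq0 ?lead_coef_eq0.
    rewrite hornerM mulf_eq0 negb_or => /andP[cb Ab].
    have /closed_rootP[t At] : size (map_poly (horner_eval b) A) != 1%N.
      by rewrite size_map_poly_id0.
    pose p := v0 + b *: v1 + t *: q.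
    have pn0 : p != 0.
      have := @free3_comb _ _ _ _ 1 b t fr; rewrite scale1r; apply.
      by rewrite oner_eq0.
    pose a1 := A.[t%:P]; pose a2 := map_poly (horner_eval b) A.
    have a1b : a1.[b] = 0.
      have := horner_map (horner_eval b) A t%:P.
      by rewrite /= /horner_eval hornerC (eqP At) => <-.
    have e1 : c * line_poly (v0 + t *: q) v1 F = B.[t%:P] * a1 ^+ 2.
      by rewrite -ft -hornerZ cf hornerM horner_exp.
    have e2 : c.[b] *: line_poly (v0 + b *: v1) q F =
              map_poly (horner_eval b) B * a2 ^+ 2.
      by rewrite -fx -[c.[b]]horner_evalE -map_polyZ cf rmorphM rmorphXn.
    (* A zero of a squared factor is a zero of the product and of its derivative; this is applied
       along v1 and along q. *)
    have double (r g h : {poly C}) x : r.[x] != 0 -> g.[x] = 0 ->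
        forall l, r * l = h * g ^+ 2 -> l.[x] = 0 /\ l^`().[x] = 0.
      move=> rx gx l rl.
      have lx : l.[x] = 0.
        apply/eqP; have := congr1 (horner^~ x) rl.
        rewrite !hornerM gx !mulr0 => /eqP.
        by rewrite mulf_eq0 (negPf rx).
      split=> //; apply/eqP; have := congr1 (fun l => l^`().[x]) rl.
      rewrite expr2 !(derivM, hornerD, hornerM) gx lx !(mulr0, mul0r, addr0, add0r).
      by move/eqP; rewrite mulf_eq0 (negPf rx).
    have [Fp D1] := double _ _ _ _ cb a1b _ e1.
    have cb' : (c.[b]%:P).[t] != 0 by rewrite hornerC.
    have [_ Dq] := double _ _ _ _ cb' (eqP At) _ (etrans (mul_polyC _ _) e2).
    have pE : v0 + t *: q + b *: v1 = p by rewrite addrAC.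
    rewrite horner_line pE in Fp.
    rewrite line_poly_deriv pE in D1; rewrite line_poly_deriv -/p in Dq.
    have [w /eqP[]] := smooth_dir sm pn0 Fp.
    (* The derivatives at p along v1 and q vanish by [double], and along p by Euler's relation; a
       basis of such directions makes p singular. *)
    have fr' : free3 p v1 q.
      move=> x y z; rewrite !scalerDr !scalerA => xyz.
      have := fr x (x * b + y) (x * t + z); rewrite !scalerDl.
      rewrite (_ : _ + _ =
        x *: v0 + (x * b) *: v1 + (x * t) *: q + y *: v1 + z *: q); last first.
        by rewrite -!addrA; congr (_ + (_ + _)); rewrite addrCA.
      by rewrite xyz => /(_ erefl)[-> /eqP + /eqP]; rewrite !mul0r !add0r => /eqP-> /eqP->.
    have [x [y [z ->]]] := free3_span w fr'.
    rewrite !dir_derivD !dir_derivZ D1 Dq (euler_zero hF Fp).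
    by rewrite !mulr0 !addr0.
  by rewrite unlock.
move=> /eqpP[[k l] /= /andP[kn0 ln0] E].
(* The Bezout identity for f and its derivative has right-hand side l, free of t; it can be
   specialized wherever l(b) is nonzero. *)
exists l => [//|b lb].
rewrite unlock -fx deriv_map; apply/Bezout_coprimepP.
pose ev := map_poly (horner_eval b).
exists (ev (k *: g), ev (k *: h)); rewrite /= -!rmorphM -rmorphD /=.
rewrite -!scalerAl -scalerDr E map_polyZ rmorph1 /= alg_polyC.
by rewrite polyC_eqp1.
Qed.

End Lines.

(** * Projective points and curves with the same zeros *)

Section Points.
Variable C : fieldType.
Implicit Types (F G : {mpoly C[3]}) (v w : 'rV[C]_3) (A : 'M[C]_3).

Lemma dim1_line (U : {vspace 'rV[C]_3}) : \dim U = 1%N ->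
  exists2 v, v != 0 & U = <[v]>%VS.
Proof.
move=> dU; have U0 : vpick U != 0.
  by rewrite vpick0; apply: contra_eq_neq dU => ->; rewrite dimv0.
exists (vpick U) => //; apply/esym/eqP; rewrite eqEdim -memvE memv_pick.
by rewrite dim_vline U0 dU.
Qed.

Lemma vline_scale v a : a != 0 -> <[a *: v]>%VS = <[v]>%VS.
Proof.
move=> a0; apply/eqP; rewrite eqEsubv -!memvE memvZ ?memv_line//=.
by rewrite -[X in X \in _](scalerK a0) memvZ ?memv_line.
Qed.

Lemma vline_inj v w : v != 0 -> <[v]>%VS = <[w]>%VS ->
  exists2 a, a != 0 & v = a *: w.
Proof.
move=> vn0 vw; have /vlineP[a va] : v \in <[w]>%VS by rewrite -vw memv_line.
by exists a => //; apply: contraNneq vn0 => a0; rewrite va a0 scale0r.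
Qed.

Lemma proj_act_line A v : proj_act A <[v]>%VS = <[v *m A]>%VS.
Proof. by rewrite /proj_act limg_line lfunE. Qed.

Lemma iter_proj_act_line A v k :
  iter k (proj_act A) <[v]>%VS = <[v *m A ^+ k]>%VS.
Proof.
elim: k => [|k IH]; first by rewrite expr0 mulmx1.
by rewrite iterS IH proj_act_line exprSr mulmxA.
Qed.

End Points.

Section ZeroLocus.
Variable C : numClosedFieldType.
Implicit Types (F G : {mpoly C[3]}) (v w : 'rV[C]_3) (A B : 'M[C]_3).

Lemma zero_locus_line d F v : F \is d.-homog -> v != 0 ->
  zero_locus F <[v]>%VS <-> F.@[v ord0] = 0.
Proof.
move=> hF vn0; split=> [[_]|Fv]; first by apply; exact: memv_line.
split=> [|w /vlineP[a ->]]; first by rewrite dim_vline vn0.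
by rewrite (homog_scale _ _ hF) Fv mulr0.
Qed.

Lemma mul_unit_neq0 A v : A \in unitmx -> v != 0 -> v *m A != 0.
Proof.
move=> Au; apply: contraNneq => vA.
by rewrite -(mulmxK Au v) vA mul0mx.
Qed.

Lemma linear_automorphism_zero d F A v : F \is d.-homog ->
  linear_automorphism F A -> v != 0 ->
  F.@[(v *m A) ord0] = 0 <-> F.@[v ord0] = 0.
Proof.
move=> hF [Au AF] vn0; have vAn0 := mul_unit_neq0 Au vn0.
rewrite -(zero_locus_line hF vn0) -(zero_locus_line hF vAn0) -proj_act_line.
split=> [|Fv]; last by rewrite -AF; exists <[v]>%VS.
rewrite -{1}AF => -[U FU]; have [u un0 e] := dim1_line FU.1.
rewrite e !proj_act_line => /(vline_inj (mul_unit_neq0 Au un0))[a a0].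
rewrite scalemxAl => /(can_inj (mulmxK Au)) uv.
by rewrite -(vline_scale v a0) -uv -e.
Qed.

Lemma smooth_neq0 d F : smooth_plane_curve d F -> F != 0.
Proof.
move=> [hF sm]; apply/eqP => F0.
have n0 : delta_mx ord0 i0 <> 0 :> 'rV[C]_3.
  by move=> /matrixP/(_ ord0 i0)/eqP; rewrite !mxE !eqxx oner_eq0.
have [|i []] := sm _ n0; first by rewrite F0 meval0.
by rewrite F0 mderiv0 meval0.
Qed.

Lemma smooth_off_point d F : smooth_plane_curve d F ->
  exists q : 'rV[C]_3, F.@[q ord0] != 0.
Proof.
move=> sm; have [//|none] := pselect (exists q : 'rV[C]_3, F.@[q ord0] != 0).
case/eqP: (smooth_neq0 sm); apply: mpoly_ext => v; rewrite meval0; apply/eqP.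
by apply: contraT => Fv; case: none; exists v.
Qed.

Lemma off_point_neq0 d F v : (0 < d)%N -> F \is d.-homog -> F.@[v ord0] != 0 -> v != 0.
Proof.
by move=> d0 hF; apply: contraNneq => ->; rewrite (homog_eval0 hF d0).
Qed.

Lemma size_line_poly_off d F v (q : 'rV[C]_3) : F \is d.-homog -> F.@[q ord0] != 0 ->
  size (line_poly v q F) = d.+1 /\ lead_coef (line_poly v q F) = F.@[q ord0].
Proof.
move=> hF Fq; have [sz cd] := line_poly_homog v q hF.
have s : size (line_poly v q F) = d.+1.
  apply/eqP; rewrite eqn_leq sz ltnNge; apply: contra Fq => le.
  by rewrite -cd nth_default.
by rewrite lead_coefE s.
Qed.

(* On a line through q meeting F = 0 transversally, the d distinct zeros of F
   determine the restriction of G up to a constant, which does not depend on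
   the line since it is the quotient of the values at q. *)
Lemma smooth_same_zeros d F G : (0 < d)%N ->
  smooth_plane_curve d F -> G \is d.-homog ->
  (forall v, v != 0 -> F.@[v ord0] = 0 <-> G.@[v ord0] = 0) ->
  exists2 c, c != 0 & G = c *: F.
Proof.
move=> d0 sm hG FG; have [hF _] := sm.
have [q Fq] := smooth_off_point sm.
have qn0 := off_point_neq0 d0 hF Fq.
have Gq : G.@[q ord0] != 0 by apply: contra Fq => /eqP/(FG _ qn0)->.
have [v1 [v0 /free3_rot/free3_swap fr]] := free3_complete qn0.
have [r rn0 tr] := smooth_transversal d0 sm fr Fq.
pose c := G.@[q ord0] / F.@[q ord0].
exists c; first by rewrite mulf_neq0 ?invr_eq0.
apply/eqP; rewrite -subr_eq0; apply/eqP; set H := G - c *: F.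
have hH : H \is d.-homog by rewrite rpredB ?rpredZ.
have good b t : r.[b] != 0 -> H.@[(v0 + b *: v1 + t *: q) ord0] = 0.
  move=> rb; have := tr b rb; set u := v0 + b *: v1.
  have [sf lf] := size_line_poly_off u hF Fq.
  have [sg lg] := size_line_poly_off u hG Gq.
  have [s fE] := closed_field_poly_normal (line_poly u q F).
  have szs : size s = d.
    move: sf; rewrite fE size_scale ?lf// size_prod_XsubC => -[//].
  rewrite fE (eqp_separable (eqp_scale _ _)) ?lf// separable_prod_XsubC => us.
  have rs : all (root (line_poly u q G)) s.
    apply/allP => z zs; rewrite /root horner_line; apply/eqP/FG.
      have := @free3_comb _ _ _ _ 1 b z fr; rewrite scale1r; apply.
      by rewrite oner_eq0.
    rewrite -horner_line fE hornerZ; apply/eqP; rewrite mulf_eq0; apply/orP; right.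
    by rewrite -/(root _ _) root_prod_XsubC.
  have gE := all_roots_prod_XsubC (etrans sg (congr1 S (esym szs))) rs.
  rewrite uniq_rootsE in gE; have {}gE := gE us.
  have := horner_line G u q t; have := horner_line F u q t.
  rewrite gE fE lf lg !hornerZ /H mevalB mevalZ => <- <-.
  by rewrite /c mulrA divfK ?subrr.
(* For fixed t the value is a polynomial in b, so the finitely many non-transversal lines do not
   matter. *)
have all1 b t : H.@[(v0 + b *: v1 + t *: q) ord0] = 0.
  rewrite addrAC -horner_line.
  suff -> : line_poly (v0 + t *: q) v1 H = 0 by rewrite horner0.
  by apply: (poly_vanish_off rn0) => x rx; rewrite horner_line addrAC good.
apply: mpoly_ext => v; rewrite meval0.
have [y [x [t ->]]] := free3_span v fr.
rewrite -addrA addrC -horner_line.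
suff -> : line_poly (x *: v1 + t *: q) v0 H = 0 by rewrite horner0.
have Xn0 : 'X != 0 :> {poly C} by rewrite -size_poly_eq0 size_polyX.
apply: (poly_vanish_off Xn0) => z; rewrite hornerX => zn0.
rewrite horner_line addrC addrA.
have -> : z *: v0 + x *: v1 + t *: q = z *: (v0 + (x / z) *: v1 + (t / z) *: q).
  by rewrite !scalerDr !scalerA ![z * (_ / z)]mulrC !divfK.
by rewrite (homog_scale _ _ hH) all1 mulr0.
Qed.

Lemma scalar_of_eigenvectors B :
  (forall v, v != 0 -> exists c, v *m B = c *: v) -> exists c, B = c%:M.
Proof.
move=> ev; pose e i : 'rV[C]_3 := delta_mx ord0 i.
have e0 i : e i != 0.
  by apply/eqP => /matrixP/(_ ord0 i)/eqP; rewrite !mxE !eqxx oner_eq0.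
have [c ec] := ev _ (e0 i0); exists c; apply/row_matrixP => i.
rewrite !rowE -/(e i) mul_mx_scalar.
have [->//|ni] := eqVneq i i0; have [ci eci] := ev _ (e0 i).
have n0 : e i0 + e i != 0.
  apply/eqP => /matrixP/(_ ord0 i)/eqP.
  by rewrite !mxE !eqxx (negPf ni) add0r oner_eq0.
have [c' ] := ev _ n0; rewrite mulmxDl ec eci => /rowP E.
have := E i0; have := E i; rewrite !mxE !eqxx (negPf ni) [i0 == i]eq_sym (negPf ni).
by rewrite !mulr0 !mulr1 !add0r !addr0 => -> ->.
Qed.

(* Three eigenvectors u + t_i q spanning distinct lines of a plane force the
   plane to be an eigenspace, so every point off the curve is fixed as well. *)
Lemma fixes_curve_scalar d F B : (2 < d)%N -> smooth_plane_curve d F ->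
  (forall v, v != 0 -> F.@[v ord0] = 0 -> exists c, v *m B = c *: v) ->
  exists c, B = c%:M.
Proof.
move=> d2 sm ev; have [hF _] := sm; have d0 : (0 < d)%N by exact: leq_trans d2.
apply: scalar_of_eigenvectors => q qn0.
have [/ev|/eqP Fq] := pselect (F.@[q ord0] = 0); first exact.
have [v1 [v0 /free3_rot/free3_swap fr]] := free3_complete qn0.
have [r rn0 tr] := smooth_transversal d0 sm fr Fq.
have [b rb] := poly_nonroot rn0; have := tr b rb; set u := v0 + b *: v1.
have [sf lf] := size_line_poly_off u hF Fq.
have [s fE] := closed_field_poly_normal (line_poly u q F).
have szs : size s = d.
  by move: sf; rewrite fE size_scale ?lf// size_prod_XsubC => -[].
rewrite fE (eqp_separable (eqp_scale _ _)) ?lf// separable_prod_XsubC => us.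
have eig t : t \in s -> exists c, (u + t *: q) *m B = c *: (u + t *: q).
  move=> ts; apply: ev.
    have := @free3_comb _ _ _ _ 1 b t fr; rewrite scale1r; apply.
    by rewrite oner_eq0.
  rewrite -horner_line fE hornerZ; apply/eqP; rewrite mulf_eq0; apply/orP; right.
  by rewrite -/(root _ _) root_prod_XsubC.
move: d2; rewrite -szs => d2; case: s us eig d2 {fE szs} => [|t1 [|t2 [|t3 s]]] //=.
rewrite !inE !negb_or -!andbA => /and5P[t12 t13 _ t23 _] eig _.
have [|m1 e1] := eig t1; first by rewrite !inE eqxx.
have [|m2 e2] := eig t2; first by rewrite !inE eqxx ?orbT.
have [|m3 e3] := eig t3; first by rewrite !inE eqxx ?orbT.
have qB (x : 'rV[C]_3) t t' m m' : (x + t *: q) *m B = m *: (x + t *: q) ->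
    (x + t' *: q) *m B = m' *: (x + t' *: q) ->
    (t - t') *: (q *m B) = (m - m') *: x + (m * t - m' * t') *: q.
  rewrite !mulmxDl -!scalemxAl !scalerBl !scalerDr !scalerA => E E'.
  have -> : t *: (q *m B) = m *: x + (m * t) *: q - x *m B.
    by rewrite -E addrAC subrr add0r.
  have -> : t' *: (q *m B) = m' *: x + (m' * t') *: q - x *m B.
    by rewrite -E' addrAC subrr add0r.
  by rewrite opprB addrA subrK opprD addrACA.
have fru x y : x *: u + y *: q = 0 -> x = 0 /\ y = 0.
  by rewrite /u scalerDr scalerA => /fr[].
clearbody u; have q12 := qB _ _ _ _ _ e1 e2; have q13 := qB _ _ _ _ _ e1 e3.
(* Elimination of q B between [q12] and [q13]. Both coefficients vanish, and the second minus t3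
   times the first equals (t1 - t3) (t2 - t3) (m1 - m2). *)
have : ((t1 - t3) * (m1 - m2) - (t1 - t2) * (m1 - m3)) *: u +
  ((t1 - t3) * (m1 * t1 - m2 * t2) - (t1 - t2) * (m1 * t1 - m3 * t3)) *: q = 0.
  have : (t1 - t3) *: ((t1 - t2) *: (q *m B)) = (t1 - t2) *: ((t1 - t3) *: (q *m B)).
    by rewrite !scalerA mulrC.
  rewrite q12 q13 => /eqP; rewrite -subr_eq0 => /eqP <-.
  by rewrite !scalerDr !scalerA opprD addrACA -!scalerBl.
case/fru => p1 p2.
have m12 : m1 = m2.
  apply/eqP; rewrite -subr_eq0.
  have : (t1 - t3) * (t2 - t3) * (m1 - m2) = 0.
    by rewrite -[RHS]p2 -[RHS]subr0 -[X in _ = _ - X](mulr0 t3) -p1; ring.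
  move/eqP; rewrite !mulf_eq0 !subr_eq0 (negPf t13) (negPf t23).
  by [].
exists m1; move: q12; rewrite -m12 subrr scale0r add0r -mulrBr.
rewrite [m1 * _]mulrC -scalerA => /scalerI -> //.
by rewrite subr_eq0.
Qed.

End ZeroLocus.

(** * Linear substitutions *)

Section Substitution.
Variable C : numClosedFieldType.
Implicit Types (F G H : {mpoly C[3]}) (v w : 'rV[C]_3) (A B : 'M[C]_3).

Lemma mpoly_mxM G H A : mpoly_mx (G * H) A = mpoly_mx G A * mpoly_mx H A.
Proof. exact: rmorphM. Qed.

Lemma mpoly_mxD G H A : mpoly_mx (G + H) A = mpoly_mx G A + mpoly_mx H A.
Proof. exact: raddfD. Qed.

Lemma mpoly_mxN G A : mpoly_mx (- G) A = - mpoly_mx G A.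
Proof. exact: raddfN. Qed.

Lemma mpoly_mx_sum (I : Type) (r : seq I) (P : pred I) (G : I -> {mpoly C[3]}) A :
  mpoly_mx (\sum_(i <- r | P i) G i) A = \sum_(i <- r | P i) mpoly_mx (G i) A.
Proof. exact: raddf_sum. Qed.

Lemma mpoly_mx_prod (I : Type) (r : seq I) (P : pred I) (G : I -> {mpoly C[3]}) A :
  mpoly_mx (\prod_(i <- r | P i) G i) A = \prod_(i <- r | P i) mpoly_mx (G i) A.
Proof. exact: rmorph_prod. Qed.

Lemma mpoly_mxXn G A n : mpoly_mx (G ^+ n) A = mpoly_mx G A ^+ n.
Proof. exact: rmorphXn. Qed.

Lemma mpoly_mxZ a G A : mpoly_mx (a *: G) A = a *: mpoly_mx G A.
Proof. exact: comp_mpolyZ. Qed.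

Lemma mpoly_mxC a A : mpoly_mx a%:MP A = a%:MP.
Proof. exact: comp_mpolyC. Qed.

Lemma mpoly_mx_mul G A B : mpoly_mx (mpoly_mx G A) B = mpoly_mx G (B *m A).
Proof. by apply: mpoly_ext => v; rewrite !mpoly_mxE mulmxA. Qed.

Lemma mpoly_mx1 G : mpoly_mx G 1%:M = G.
Proof. by apply: mpoly_ext => v; rewrite mpoly_mxE mulmx1. Qed.

Lemma mpoly_mx_scale d G a A : G \is d.-homog ->
  mpoly_mx G (a *: A) = a ^+ d *: mpoly_mx G A.
Proof.
move=> hG; apply: mpoly_ext => v.
by rewrite mevalZ !mpoly_mxE -scalemxAr (homog_scale _ _ hG).
Qed.

Lemma dhomog_mpoly_mx d G A : G \is d.-homog -> mpoly_mx G A \is d.-homog.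
Proof.
move=> /dhomogP hG; rewrite /mpoly_mx comp_mpolyEX big_seq.
apply: rpred_sum => m /hG /= <-; apply: rpredZ; rewrite comp_mpolyX mdegE.
apply: (big_ind2 (fun p k => p \is k.-homog)) => [|p k q l|i _]; first exact: dhomog1.
  exact: dhomogM.
rewrite -[X in X.-homog]mul1n; apply: dhomogMn; rewrite tnth_map tnth_ord_tuple.
by apply: rpred_sum => j _; apply: rpredZ; rewrite dhomogX /= mdeg1.
Qed.

Lemma mpoly_mxK G A : A \in unitmx -> mpoly_mx (mpoly_mx G A) (invmx A) = G.
Proof. by move=> Au; rewrite mpoly_mx_mul mulVmx // mpoly_mx1. Qed.

Lemma linear_automorphism_semiinvariant d F A : (0 < d)%N ->
  smooth_plane_curve d F -> linear_automorphism F A ->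
  exists2 l, l != 0 & mpoly_mx F A = l *: F.
Proof.
move=> d0 sm AF; have [hF _] := sm.
apply: (smooth_same_zeros d0 sm (dhomog_mpoly_mx A hF)) => v vn0.
by rewrite mpoly_mxE (linear_automorphism_zero hF AF vn0).
Qed.

(** Translates the order of g, which is defined by the action on the curve, into a condition on the
    matrix A. *)
Lemma trivial_power_scalar d F A k : (2 < d)%N -> smooth_plane_curve d F ->
  A \in unitmx -> trivial_power F A k <-> exists c, A ^+ k = c%:M.
Proof.
move=> d2 sm Au; have [hF _] := sm; split=> [tr|[c Ak] U [dU _]].
  apply: (fixes_curve_scalar d2 sm) => v vn0 Fv.
  have := tr _ ((zero_locus_line hF vn0).2 Fv).
  rewrite iter_proj_act_line => e.
  have Akv : v *m A ^+ k != 0.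
    elim: (k) => [|j IH]; first by rewrite expr0 mulmx1.
    by rewrite exprSr mulmxA mul_unit_neq0.
  by have [a _ ->] := vline_inj Akv e; exists a.
have [v vn0 ->] := dim1_line dU; rewrite iter_proj_act_line Ak mul_mx_scalar.
rewrite vline_scale //; apply: contraTneq vn0 => c0.
have Aku : A ^+ k \in unitmx by exact: unitrX.
by rewrite -(mulmxK Aku v) Ak c0 mul_mx_scalar scale0r mul0mx eqxx.
Qed.

(** The minimal polynomial divides X^m - c, which has simple roots because c is nonzero. *)
Lemma finite_order_diagonal A m c : (0 < m)%N -> A \in unitmx -> A ^+ m = c%:M ->
  exists v0 v1 v2 a0 a1 a2, [/\ free3 v0 v1 v2, v0 *m A = a0 *: v0,
    v1 *m A = a1 *: v1 & v2 *m A = a2 *: v2].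
Proof.
move=> m0 Au Am.
have cn0 : c != 0.
  have Amu : A ^+ m \in unitmx by exact: unitrX.
  apply: contraTneq Amu => c0; rewrite Am c0 raddf0.
  by rewrite -[_ \in _]/(_ \is a GRing.unit) unitr0.
pose p : {poly C} := 'X^m - c%:P.
have sp : separable_poly p.
  (* The identity is - m (X^m - c) + X m X^(m-1) = m c. *)
  rewrite unlock; apply/Bezout_coprimepP; exists (- m%:R%:P, 'X) => /=.
  rewrite (_ : _ + _ = (m%:R * c)%:P); last first.
    rewrite /p derivB derivXn derivC subr0 mulrnAr -exprS prednK //.
    have -> : 'X^m *+ m = m%:R%:P * 'X^m :> {poly C}.
      by rewrite mul_polyC scaler_nat.
    by rewrite polyCM; ring.
  by rewrite polyC_eqp1 mulf_neq0 // pnatr_eq0 -lt0n.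
have [s pE] := closed_field_poly_normal p.
have lp : lead_coef p != 0 by rewrite lead_coefXnsubC ?oner_eq0.
have us : uniq s by rewrite -separable_prod_XsubC -(eqp_separable (eqp_scale _ lp)) -pE.
have /diagonalizableP[P Pu] : exists2 rs, uniq rs &
    mxminpoly A %| \prod_(x <- rs) ('X - x%:P).
  exists s => //; rewrite -(dvdpZr _ _ lp) -pE; apply: mxminpoly_min.
  by rewrite rmorphB rmorphXn /= horner_mx_X horner_mx_C Am subrr.
move=> /(diagonalizable_forLR Pu)[D AE]. rewrite mxpoly.conjVmx // in AE.
exists (row i0 P), (row i1 P), (row i2 P), (D ord0 i0), (D ord0 i1), (D ord0 i2).
have ev i : row i P *m A = D ord0 i *: row i P.
  by rewrite AE rowE !mulmxA mulmxK // -rowE row_diag_mx -scalemxAl.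
by split; [exact: free3_rows|..].
Qed.

End Substitution.

(** * Eisenstein's criterion *)

Section Eisenstein.
Variable S : idomainType.
Implicit Types (c l g : {poly S}) (A B P Q : {poly {poly S}}).
Local Notation at0 := (map_poly (horner_eval (0 : S))).

Lemma scale_polyI (T : idomainType) (c : T) : c != 0 ->
  injective (fun p : {poly T} => c *: p).
Proof.
move=> cn0 p q; rewrite -!mul_polyC => /mulfI; apply.
by rewrite polyC_eq0.
Qed.

Lemma at0_eq0 A : at0 A = 0 -> A = 'X *: map_poly (drop_poly 1) A.
Proof.
move=> /polyP A0; apply/polyP => i; rewrite coefZ coef_map /=.
apply/polyP => j; rewrite coefXM coef_drop_poly.
case: j => [|j] /=; last by rewrite addn1.
by have := A0 i; rewrite coef_map coef0 /= /horner_eval horner_coef0.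
Qed.

(** Eisenstein at the prime x of S[x], which divides g exactly once and does not divide l.
    Divisibility over the fraction field of S[x] provides factorizations of a multiple c F only;
    hence the factor c, from which powers of x are removed by induction on its size. *)
Lemma eisenstein_irreducible l g m c A B : (0 < m)%N ->
  l`_0 != 0 -> g`_0 = 0 -> g`_1 != 0 -> c != 0 ->
  c *: (l *: 'X^m + g%:P) = A * B -> (size A <= 1)%N \/ (size B <= 1)%N.
Proof.
move=> m0 l0 g0 g1; have [n] := ubnP (size c).
elim: n c A B => // n IH c A B szc cn0 E.
have sF : size (l *: 'X^m + g%:P) = m.+1.
  have ln0 : l != 0 by apply: contraNneq l0 => ->; rewrite coef0.
  rewrite size_polyDl size_scale // size_polyXn //.
  by rewrite ltnS (leq_trans (size_polyC_leq1 _)).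
have Fn0 : l *: 'X^m + g%:P != 0 by rewrite -size_poly_eq0 sF.
have /eqP : A * B != 0 by rewrite -E scale_poly_eq0 (negPf cn0).
move/eqP; rewrite mulf_eq0 negb_or => /andP[An0 Bn0].
(* If x divides c, it divides A or B, because A B vanishes modulo x and S[Z] is a domain; x is then
   cancelled. *)
have [c0|c0] := eqVneq c`_0 0.
  have cE : c = drop_poly 1 c * 'X.
    apply/polyP => j; rewrite coefMX; case: j => [|j] //=.
    by rewrite coef_drop_poly addn1.
  have dcn0 : drop_poly 1 c != 0 by apply: contraNneq cn0 => dc; rewrite cE dc mul0r.
  have sdc : (size (drop_poly 1 c) < n)%N.
    rewrite size_drop_poly subn1 -ltnS prednK // lt0n size_poly_eq0.
    by [].
  have Xn0 : 'X != 0 :> {poly S} by rewrite polyX_eq0.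
  have : at0 A * at0 B = 0.
    rewrite -rmorphM -E /= map_polyZ /= /horner_eval horner_coef0 c0.
    by rewrite scale0r.
  move/eqP; rewrite mulf_eq0 => /orP[/eqP/at0_eq0 AE|/eqP/at0_eq0 BE].
    move: E; rewrite cE AE mulrC -scalerA -scalerAl => /(scale_polyI Xn0) E.
    have := IH _ _ _ sdc dcn0 E.
    by rewrite AE size_scale.
  move: E; rewrite cE BE mulrC -scalerA -scalerAr => /(scale_polyI Xn0) E.
  have := IH _ _ _ sdc dcn0 E.
  by rewrite BE size_scale.
have [|sA] := leqP (size A) 1; first by left.
have [|sB] := leqP (size B) 1; first by right.
have sAB : (size A + size B)%N = m.+2.
  have := size_mul An0 Bn0; rewrite -E size_scale // sF.
  by case: (size A) sA => // k _; rewrite addSn /= => ->.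
have E0 : at0 A * at0 B = (c`_0 * l`_0) *: 'X^m.
  rewrite -rmorphM -E /= map_polyZ rmorphD /= map_polyZ map_polyXn map_polyC /=.
  by rewrite /horner_eval !horner_coef0 g0 addr0 scalerA.
have cl0 : c`_0 * l`_0 != 0 by rewrite mulf_neq0.
(* Modulo x the product is a nonzero multiple of Z^m. If A' had nonzero constant term there, Z^m
   would divide B', whose degree is less than m. *)
have coef00 A' B' : at0 A' * at0 B' = (c`_0 * l`_0) *: 'X^m ->
    (size B' <= m)%N -> (at0 A')`_0 = 0.
  move=> E' sB'; apply/eqP; apply: contraT => A0.
  have cop : coprimep 'X^m (at0 A').
    rewrite coprimep_expl // coprimep_sym -['X]subr0 -polyC0 coprimep_XsubC.
    by rewrite /root horner_coef0.
  have : 'X^m %| at0 B'.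
    rewrite -(Gauss_dvdpr _ cop) E' dvdpZr //.
  move/dvdp_leq; rewrite size_polyXn => /(_ _)/leq_trans le.
  have B'n0 : at0 B' != 0.
    apply: contraTneq cl0 => B0; move/eqP: E'; rewrite B0 mulr0 eq_sym.
    by rewrite scale_poly_eq0 -size_poly_eq0 size_polyXn orbF negbK.
  have := le _ B'n0 (leq_trans (size_poly _ _) sB').
  by rewrite ltnn.
have A00 : (A`_0)`_0 = 0.
  have := coef00 A B E0; rewrite coef_map /= /horner_eval horner_coef0; apply.
  by have : ((size B).+2 <= m.+2)%N by rewrite -sAB -add2n leq_add2r.
have B00 : (B`_0)`_0 = 0.
  rewrite mulrC in E0.
  have := coef00 B A E0; rewrite coef_map /= /horner_eval horner_coef0; apply.
  by have : ((size A).+2 <= m.+2)%N by rewrite -sAB -addn2 leq_add2l.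
(* x divides both factors on the right, so x^2 would divide c g, whose coefficient of x is c(0) g_1,
   a nonzero element. *)
have : c * g = A`_0 * B`_0.
  have := congr1 (fun p : {poly {poly S}} => p`_0) E.
  rewrite coefZ coefM big_ord1 subnn => <-.
  by rewrite coefD coefZ coefXn coefC eq_sym gtn_eqF // mulr0 add0r.
move/(congr1 (fun p : {poly S} => p`_1)); rewrite !coefM !big_ord_recl !big_ord0 /=.
rewrite g0 A00 B00 !mulr0 !mul0r !addr0 => /eqP.
by rewrite mulf_eq0 (negPf c0) (negPf g1).
Qed.

(** Irreducibility is applied to the gcd of F and P: either the cofactor is constant and F divides
    P, or the gcd is constant and Gauss's lemma applies. Here [%|] allows a nonzero factor from
    S[x]. *)
Lemma eisenstein_prime l g m P Q : (0 < m)%N ->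
  l`_0 != 0 -> g`_0 = 0 -> g`_1 != 0 ->
  let F := l *: 'X^m + g%:P in F %| P * Q -> F %| P \/ F %| Q.
Proof.
move=> m0 l0 g0 g1 F FPQ.
have /Pdiv.Idomain.dvdpP[[c B] /= cn0 E] := dvdp_gcdl F P.
have [sB|sg] := eisenstein_irreducible m0 l0 g0 g1 cn0 E.
  left; apply: dvdp_trans (dvdp_gcdr F P).
  have Bn0 : B`_0 != 0.
    apply: contraTneq cn0 => B0; have := E.
    rewrite (size1_polyC sB) B0 mul0r => /eqP; rewrite scale_poly_eq0.
    case/orP => [/eqP->|]; first by rewrite eqxx.
    move/eqP/(congr1 (fun p : {poly {poly S}} => p`_m)).
    rewrite coefD coefZ coefXn eqxx mulr1 coefC gtn_eqF // addr0 coef0 => l_0.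
    by move: l0; rewrite l_0 coef0 eqxx.
  by rewrite -(dvdpZr _ _ Bn0) -mul_polyC -(size1_polyC sB) -E dvdpZr.
right; rewrite -(Gauss_dvdpr Q (d := F) (q := P)) //.
rewrite /coprimep eqn_leq sg lt0n size_poly_eq0.
apply: contraNneq g1 => g_0; move: E; rewrite g_0 mulr0 => /eqP.
rewrite scale_poly_eq0 (negPf cn0) /= => /eqP/(congr1 (fun p : {poly {poly S}} => p`_0)).
rewrite coefD coefZ coefXn coefC eq_sym gtn_eqF // mulr0 add0r coef0 => ->.
by rewrite coef0.
Qed.
End Eisenstein.

(** * Linear forms modulo the equation *)

Section Regular.
Variable C : numClosedFieldType.
Implicit Types (F G H P Q : {mpoly C[3]}) (v w : 'rV[C]_3) (A : 'M[C]_3).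

Lemma homog1_add H v w : H \is 1.-homog ->
  H.@[(v + w) ord0] = H.@[v ord0] + H.@[w ord0].
Proof.
move=> hH; have [sz c1] := line_poly_homog v w hH.
rewrite -[w in LHS]scale1r -horner_line (horner_coef_wide _ sz).
by rewrite !big_ord_recl big_ord0 /= line_poly_coef0 c1 !expr1n !mulr1 addr0.
Qed.

Lemma homog1_mul H : H \is 1.-homog ->
  exists h : 'cV[C]_3, forall v, H.@[v ord0] = (v *m h) ord0 ord0.
Proof.
move=> hH; exists (\col_i H.@[(delta_mx ord0 i : 'rV[C]_3) ord0]) => v.
rewrite {1}(row_sum_delta v) !mxE big_ord3 /= !homog1_add //.
rewrite !(homog_scale _ _ hH) !expr1 [RHS]big_ord3 /= !mxE; ring.
Qed.

(* Over the hyperplane H = 0 a polynomial agrees with its composition with a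
   projection onto that hyperplane. *)
Lemma mpoly_mx_congr H A Q : (forall i, exists S, 'X_i - mpoly_mx 'X_i A = H * S) ->
  exists S, Q - mpoly_mx Q A = H * S.
Proof.
move=> hX; elim/mpoly_ring_ind: Q => [c|//|P Q [S ES] [T ET]|P Q [S ES] [T ET]].
- by exists 0; rewrite mpoly_mxC subrr mulr0.
- by exists (S + T); rewrite mpoly_mxD mulrDr -ES -ET; ring.
- exists (S * Q + mpoly_mx P A * T).
  by rewrite mpoly_mxM mulrDr mulrA -ES mulrCA -ET; ring.
Qed.

Lemma linear_regular d F H : (1 < d)%N -> smooth_plane_curve d F ->
  H \is 1.-homog -> H != 0 -> regular_mod F H.
Proof.
move=> d1 sm hH Hn0; have [h hE] := homog1_mul hH.
have [u0 Hu0] : exists u : 'rV[C]_3, H.@[u ord0] != 0.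
  have [//|none] := pselect (exists u : 'rV[C]_3, H.@[u ord0] != 0).
  case/eqP: Hn0; apply: mpoly_ext => v; rewrite meval0; apply/eqP.
  by apply: contraT => Hv; case: none; exists v.
pose u := (H.@[u0 ord0])^-1 *: u0.
have Hu : H.@[u ord0] = 1 by rewrite (homog_scale _ _ hH) expr1 mulVf.
have un0 : u != 0.
  by apply: contra_eq_neq Hu => ->; rewrite (homog_eval0 hH) // eq_sym oner_eq0.
pose M : 'M[C]_3 := 1%:M - h *m u.
have ME v : v *m M = v - H.@[v ord0] *: u.
  rewrite mulmxBr mulmx1 mulmxA [v *m h]mx11_scalar -hE mul_scalar_mx.
  by [].
have HM v : H.@[(v *m M) ord0] = 0.
  by rewrite ME homog1_add // -scaleNr (homog_scale _ _ hH) Hu expr1 mulr1 subrr.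
have MM v : H.@[v ord0] = 0 -> v *m M = v by rewrite ME => ->; rewrite scale0r subr0.
have FMn0 : mpoly_mx F M != 0.
  have [v1 [v2 fr]] := free3_complete un0.
  have fr' : free3 (v1 *m M) (v2 *m M) u.
    move=> a b c; rewrite !ME => abc.
    have := fr (c - a * H.@[v1 ord0] - b * H.@[v2 ord0]) a b; case=> [|E a0 b0].
      by rewrite -abc; apply/rowP => i; rewrite !mxE; ring.
    by move: E; rewrite a0 b0 !mul0r !subr0.
  have [a [b]] := smooth_line_nonzero d1 sm fr'.
  apply: contraNneq => FM0.
  have := mpoly_mxE F M (a *: v1 + b *: v2); rewrite FM0 meval0 => e.
  by rewrite !scalemxAl -mulmxDl -e.
move=> P [Q E].
have QM0 : mpoly_mx Q M = 0.
  have : mpoly_mx Q M * mpoly_mx F M = 0.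
    rewrite -mpoly_mxM -E mpoly_mxM (_ : mpoly_mx H M = 0) ?mul0r//.
    by apply: mpoly_ext => v; rewrite mpoly_mxE HM meval0.
  by move/eqP; rewrite mulf_eq0 (negPf FMn0) orbF => /eqP.
have [S] : exists S, Q - mpoly_mx Q M = H * S.
  apply: mpoly_mx_congr => i; exists (u ord0 i)%:MP.
  apply: mpoly_ext => v; rewrite mevalB mpoly_mxE mevalM mevalC !mevalXU ME.
  by rewrite !mxE opprB addrCA subrr addr0.
rewrite QM0 subr0 => QE; exists S; apply: (mulfI Hn0).
by rewrite E QE mulrA.
Qed.

Lemma regular_modX F H k : regular_mod F H -> regular_mod F (H ^+ k).
Proof.
move=> rH; elim: k => [|k IH]; first by rewrite expr0; exact: regular_mod1.
by rewrite exprS; exact: regular_modM.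
Qed.

Lemma in_ideal_homog_lt d F P k : F \is d.-homog -> F != 0 -> P \is k.-homog ->
  (k < d)%N -> in_ideal F P -> P = 0.
Proof.
move=> hF Fn0 hP kd [Q E]; apply/eqP; apply: contraTT kd => Pn0; rewrite -leqNgt.
have Qn0 : Q != 0 by apply: contraNneq Pn0 => Q0; rewrite E Q0 mul0r.
have msz p j : p != 0 -> p \is j.-homog -> msize (p : {mpoly C[3]}) = j.+1.
  move=> pn0 hp; rewrite (dhomog_uniq pn0 hp (dhomog_msize hp)) prednK //.
  by rewrite lt0n mmeasure_poly_eq0.
rewrite -ltnS -(msz _ _ Pn0 hP) E msizeM // (msz _ _ Fn0 hF).
by rewrite addnS /= -[X in (X < _)%N]add0n ltn_add2r lt0n mmeasure_poly_eq0.
Qed.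

End Regular.

(** * Curves invariant under a homology *)

Lemma mcoeff_mpoly_mx_diag (C : numClosedFieldType) (P : {mpoly C[3]})
    (a : 'rV[C]_3) k :
  (mpoly_mx P (diag_mx a))@_k = P@_k * \prod_i a ord0 i ^+ k i.
Proof.
elim/mpolyind: P => [|c n p _ _ IH].
  by rewrite [mpoly_mx 0 _](raddf0 (comp_mpoly _)) mcoeff0 mul0r.
rewrite mpoly_mxD mpoly_mxZ !mcoeffD IH mulrDl; congr (_ + _).
have -> : mpoly_mx 'X_[n] (diag_mx a) = (\prod_i a ord0 i ^+ n i) *: 'X_[n].
  apply: mpoly_ext => v; rewrite mpoly_mxE mevalZ !mevalX -big_split /=.
  apply: eq_bigr => i _; rewrite -exprMn mul_mx_diag mxE mulrC.
  by [].
rewrite !mcoeffZ mcoeffX; have [->|_] := eqVneq n k; first by rewrite !mulr1.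
by rewrite !mulr0 mul0r.
Qed.

Section Homology.
Variable C : numClosedFieldType.
Implicit Types (G H P Q : {mpoly C[3]}) (v w : 'rV[C]_3).
Variables (d m : nat) (F : {mpoly C[3]}) (A : 'M[C]_3).
Variables (e0 e1 e2 : 'rV[C]_3) (zeta : C).
Hypothesis smF : smooth_plane_curve d F.
Hypothesis fr : free3 e0 e1 e2.
Hypotheses (Ae0 : e0 *m A = e0) (Ae1 : e1 *m A = e1) (Ae2 : e2 *m A = zeta *: e2).
Hypothesis prim : m.-primitive_root zeta.
Hypothesis FA : mpoly_mx F A = F.
Hypotheses (md : (m <= d)%N) (dm : (d <= m.+1)%N) (m2 : (2 < m)%N).
Hypothesis F1 : F.@[e1 ord0] = 0.

Local Notation e := (mat3 e0 e1 e2).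
Local Notation comb a b c := (a *: e0 + b *: e1 + c *: e2).

Let e_unit : e \in unitmx. Proof. exact/free3_unit. Qed.
Let hF : F \is d.-homog. Proof. by case: smF. Qed.
Let Fn0 : F != 0. Proof. exact: smooth_neq0 smF. Qed.
Let m0 : (0 < m)%N. Proof. exact: leq_trans m2. Qed.

Definition coord_form (i : 'I_3) : {mpoly C[3]} := mpoly_mx 'X_i (invmx e).
(** Projection along e2 onto the span of e0 and e1; the column [invmx e *m delta_mx i2 ord0] reads
    off the coordinate along e2. *)
Definition proj_e2 : 'M[C]_3 := 1%:M - (invmx e *m delta_mx i2 ord0) *m e2.

Lemma coord_comb a b c i :
  (coord_form i).@[(comb a b c) ord0] = tnth [tuple a; b; c] i.
Proof.
rewrite /coord_form mpoly_mxE mevalXU.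
have -> : comb a b c = (\row_i tnth [tuple a; b; c] i) *m e.
  by rewrite mul_mat3 !mxE !(tnth_nth 0).
by rewrite mulmxK // mxE.
Qed.

Lemma coord_comb0 a b c : (coord_form i0).@[(comb a b c) ord0] = a.
Proof. by rewrite coord_comb. Qed.
Lemma coord_comb1 a b c : (coord_form i1).@[(comb a b c) ord0] = b.
Proof. by rewrite coord_comb. Qed.
Lemma coord_comb2 a b c : (coord_form i2).@[(comb a b c) ord0] = c.
Proof. by rewrite coord_comb. Qed.

Lemma mpoly_ext_comb P Q :
  (forall a b c, P.@[(comb a b c) ord0] = Q.@[(comb a b c) ord0]) -> P = Q.
Proof.
by move=> PQ; apply: mpoly_ext => v; have [a [b [c ->]]] := free3_span v fr.
Qed.

Lemma comb_mulA a b c : comb a b c *m A = comb a b (c * zeta).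
Proof. by rewrite !mulmxDl -!scalemxAl Ae0 Ae1 Ae2 scalerA. Qed.

Lemma comb_proj a b c : comb a b c *m proj_e2 = comb a b 0.
Proof.
rewrite mulmxBr mulmx1 !mulmxA.
have -> : comb a b c *m invmx e *m delta_mx i2 ord0 = c%:M.
  rewrite [LHS]mx11_scalar; congr (_%:M).
  by rewrite -colE mxE -[RHS](coord_comb2 a b c) mpoly_mxE mevalXU.
by rewrite mul_scalar_mx scale0r addr0 addrK.
Qed.

Lemma coord_homog i : coord_form i \is 1.-homog.
Proof. by apply: dhomog_mpoly_mx; rewrite dhomogX /= mdeg1. Qed.

Lemma coordA i : mpoly_mx (coord_form i) A = (if i == i2 then zeta else 1) *: coord_form i.
Proof.
apply: mpoly_ext_comb => a b c; rewrite mpoly_mxE comb_mulA mevalZ !coord_comb.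
by move: i; apply: ord3P; rewrite !(tnth_nth 0) /= ?mul1r // mulrC.
Qed.

Lemma coord_proj i : i != i2 -> mpoly_mx (coord_form i) proj_e2 = coord_form i.
Proof.
move=> i2'; apply: mpoly_ext_comb => a b c.
rewrite mpoly_mxE comb_proj !coord_comb.
by move: i i2'; apply: ord3P; rewrite !(tnth_nth 0).
Qed.

Lemma coord_neq0 i : coord_form i != 0.
Proof.
apply/eqP => c0; have := coord_comb 1 1 1 i; rewrite c0 meval0.
by move: i {c0}; apply: ord3P; rewrite !(tnth_nth 0) /= => /eqP; rewrite eq_sym oner_eq0.
Qed.

(* Expansion in the coordinates of the basis e0, e1, e2; the invariance under A
   leaves only the monomials whose exponent of coord_form i2 is a multiple of m. *)
Lemma invariant_expansion k P : P \is k.-homog -> mpoly_mx P A = P ->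
  exists (s : seq 'X_{1..3}) (c : 'X_{1..3} -> C),
    (forall n, n \in s -> (n i0 + n i1 + n i2)%N = k /\ (m %| n i2)%N) /\
    P = \sum_(n <- s)
      c n *: (coord_form i0 ^+ n i0 * coord_form i1 ^+ n i1 * coord_form i2 ^+ n i2).
Proof.
move=> hP PA; pose P' := mpoly_mx P e; exists (msupp P'), (fun n => P'@_n).
have hP' : P' \is k.-homog by exact: dhomog_mpoly_mx.
split=> [n nP|].
  split.
    have := elimT (dhomogP _ _ _) hP' n nP; rewrite /= mdegE big_ord3 /= => <-.
    by rewrite addnA.
  pose D : 'M[C]_3 := diag_mx (\row_i (if i == i2 then zeta else 1)).
  have P'D : mpoly_mx P' D = P'.
    rewrite /P' mpoly_mx_mul -[in RHS]PA mpoly_mx_mul; congr (mpoly_mx P _).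
    apply/row_matrixP => i; rewrite !rowE !mulmxA.
    move: (delta_mx _ _) => u; rewrite !mul_mat3 mul_mx_diag !mxE /= comb_mulA.
    by rewrite !mulr1.
  move: (nP); rewrite mcoeff_msupp => cn0.
  have := mcoeff_mpoly_mx_diag P' (\row_i (if i == i2 then zeta else 1)) n.
  rewrite P'D big_ord3 /= !mxE /= !expr1n !mul1r => /esym/eqP.
  rewrite -subr_eq0 -[X in _ - X]mulr1 -mulrBr mulf_eq0 (negPf cn0) subr_eq0.
  by rewrite -(prim_order_dvd prim).
rewrite -[LHS](mpoly_mxK P (A := e)) // -/P' {1}[P']mpolyE mpoly_mx_sum.
apply: eq_bigr => n _; rewrite mpoly_mxZ mpolyXE_id mpoly_mx_prod big_ord3 /=.
by rewrite !mpoly_mxXn mulrA.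
Qed.

(** Forms in the two coordinates x, y. Expressing the absence of z by invariance under the
    projection makes sums and products immediate, and ties these forms to the projection field of
    e2. *)
Definition xyform k P := P \is k.-homog /\ mpoly_mx P proj_e2 = P.

Lemma xyform_mono i j : xyform (i + j) (coord_form i0 ^+ i * coord_form i1 ^+ j).
Proof.
split; last by rewrite mpoly_mxM !mpoly_mxXn !coord_proj.
apply: dhomogM; rewrite -[X in X.-homog]mul1n;
  by apply: dhomogMn; exact: coord_homog.
Qed.

Lemma xyform_sum (I : eqType) (s : seq I) (Q : pred I) (G : I -> {mpoly C[3]}) k :
  (forall i, i \in s -> Q i -> xyform k (G i)) -> xyform k (\sum_(i <- s | Q i) G i).
Proof.
move=> xG; split.
  rewrite big_seq_cond; apply: rpred_sum => i /andP[si Qi].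
  by case: (xG i si Qi).
rewrite mpoly_mx_sum big_seq_cond [RHS]big_seq_cond.
by apply: eq_bigr => i /andP[si Qi]; case: (xG i si Qi).
Qed.

Lemma xyformZ k a P : xyform k P -> xyform k (a *: P).
Proof. by move=> [hP pP]; split; rewrite ?rpredZ// mpoly_mxZ pP. Qed.

Lemma xyformM k l P Q : xyform k P -> xyform l Q -> xyform (k + l) (P * Q).
Proof.
by move=> [hP pP] [hQ pQ]; split; [exact: dhomogM|rewrite mpoly_mxM pP pQ].
Qed.

Lemma xyformX k n P : xyform k P -> xyform (k * n) (P ^+ n).
Proof.
by move=> [hP pP]; split; [exact: dhomogMn|rewrite mpoly_mxXn pP].
Qed.

(** The exponents of z are multiples of m and at most d <= m + 1 < 2 m, so they are 0 or m. *)
Lemma homology_equation : exists G L, [/\ xyform d G, xyform (d - m) L &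
  F = G + coord_form i2 ^+ m * L].
Proof.
have [s [c [sP FE]]] := invariant_expansion hF FA.
exists (\sum_(n <- s | n i2 == 0%N) c n *: (coord_form i0 ^+ n i0 * coord_form i1 ^+ n i1)).
exists (\sum_(n <- s | n i2 != 0%N) c n *: (coord_form i0 ^+ n i0 * coord_form i1 ^+ n i1)).
have n2 n : n \in s -> n i2 != 0%N -> n i2 = m.
  move=> /sP[nd /dvdnP[q nq]]; rewrite nq => qm0.
  have q1 : q = 1%N; last by rewrite q1 mul1n.
  case: q nq qm0 => [|[|q]] nq //; rewrite ?mul0n//.
  have : (2 * m <= m.+1)%N.
    apply: leq_trans dm; rewrite -nd nq (leq_trans _ (leq_addl _ _))//.
    by rewrite leq_mul2r orbT.
  by rewrite mul2n -addnn -addn1 leq_add2l leqNgt (leq_trans _ m2).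
split.
- apply: xyform_sum => n ns /eqP n0; apply: xyformZ.
  by have [<- _] := sP n ns; rewrite n0 addn0; exact: xyform_mono.
- apply: xyform_sum => n ns n0; apply: xyformZ.
  have [<- _] := sP n ns; rewrite (n2 n ns n0) addnK; exact: xyform_mono.
- rewrite [LHS]FE [LHS](bigID (fun n : 'X_{1..3} => n i2 == 0%N)) /=.
  apply: (congr2 +%R).
    by apply: eq_bigr => n /eqP ->; rewrite expr0 mulr1.
  rewrite mulr_sumr big_seq_cond [RHS]big_seq_cond.
  apply: eq_bigr => n /andP[ns n0].
  by rewrite (n2 n ns n0) -scalerAr mulrC.
Qed.

Lemma nest_xyform k P : xyform k P ->
  exists p : {poly {poly C}}, nest (mpoly_mx P e) = p%:P.
Proof.
move=> [_ pP]; pose D : 'M[C]_3 := diag_mx (\row_i (i != i2)%:R).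
have -> : mpoly_mx P e = mpoly_mx (mpoly_mx P e) D.
  rewrite -[in LHS]pP !mpoly_mx_mul; congr (mpoly_mx P _).
  apply/row_matrixP => i; rewrite !rowE !mulmxA.
  move: (delta_mx _ _) => u; rewrite !mul_mat3 mul_mx_diag !mxE /= comb_proj.
  by rewrite !mulr1 mulr0.
elim/mpoly_ring_ind: (mpoly_mx P e) => [c|i|p q [p' Ep] [q' Eq]|p q [p' Ep] [q' Eq]].
- by rewrite mpoly_mxC /nest mmapC /=; eexists.
- have -> : mpoly_mx 'X_i D = (i != i2)%:R *: 'X_i.
    apply: mpoly_ext => v.
    by rewrite mpoly_mxE mevalZ !mevalXU mul_mx_diag mxE mxE mulrC.
  rewrite /nest mmapZ mmapX mmap1U /=; move: i; apply: ord3P;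
    rewrite /nest_var (tnth_nth 0) /=.
  + by exists 'X; rewrite !polyC1 mul1r.
  + by exists ('X%:P); rewrite !polyC1 mul1r.
  + by exists 0; rewrite !polyC0 mul0r.
- by exists (p' + q'); rewrite mpoly_mxD nestD Ep Eq polyCD.
- by exists (p' * q'); rewrite mpoly_mxM nestM Ep Eq polyCM.
Qed.

Lemma horner_nest_xyform P p a b : nest (mpoly_mx P e) = p%:P ->
  p.[a%:P].[b] = P.@[(a *: e0 + b *: e1) ord0].
Proof.
move=> Ep; pose v : 'rV[C]_3 := \row_i tnth [tuple a; b; 0] i.
have := horner_nest (mpoly_mx P e) v; rewrite Ep mpoly_mxE mul_mat3 !mxE hornerC.
by rewrite !(tnth_nth 0) /= scale0r addr0.
Qed.

Lemma homology_value G L a b c : xyform d G -> xyform (d - m) L ->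
  F = G + coord_form i2 ^+ m * L ->
  F.@[(comb a b c) ord0] =
  G.@[(a *: e0 + b *: e1) ord0] + c ^+ m * L.@[(a *: e0 + b *: e1) ord0].
Proof.
move=> [_ pG] [_ pL] ->; rewrite mevalD mevalM rmorphXn /= coord_comb2.
by rewrite -{1}pG -{1}pL !mpoly_mxE comb_proj scale0r addr0.
Qed.

(** Along e1 + t e2 the equation is G(e1) + L(e1) t^m with m > 1, so the derivative along e2 is 0,
    and so is the one along e1 by Euler. Smoothness leaves only e0. Thus e1 is a simple zero of G on
    the axis. *)
Lemma tangent_e0 : dir_deriv F e1 e0 != 0.
Proof.
have [G [L [xG xL FE]]] := homology_equation.
have e1n0 : e1 != 0 by exact: free3_neq0 (free3_swap fr).
apply/eqP => D0; have [w /eqP[]] := smooth_dir smF e1n0 F1.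
have [a [b [c ->]]] := free3_span w fr.
rewrite !dir_derivD !dir_derivZ D0 (euler_zero hF F1) -line_poly_coef1.
suff -> : line_poly e1 e2 F = (G.@[e1 ord0])%:P + L.@[e1 ord0] *: 'X^m.
  rewrite coefD coefC coefZ coefXn /= [1%N == m]ltn_eqF; last exact: leq_trans m2.
  by rewrite !(mulr0, addr0).
apply/eqP; rewrite -subr_eq0; apply/eqP/poly_vanish => t.
have := homology_value 0 1 t xG xL FE.
rewrite scale0r scale1r add0r hornerD hornerN horner_line => ->.
by rewrite !hornerE; ring.
Qed.

(** Otherwise F would vanish on the whole line through e1 and e2. *)
Lemma homology_coef_neq0 G L : xyform d G -> xyform (d - m) L ->
  F = G + coord_form i2 ^+ m * L -> L.@[e1 ord0] != 0.
Proof.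
move=> xG xL FE; have Feval a b c := homology_value a b c xG xL FE.
apply/eqP => L0.
have [b [c]] := smooth_line_nonzero (leq_trans (ltnW m2) md) smF (free3_rot fr).
have := Feval 0 b c; rewrite scale0r add0r => ->.
have <- : F.@[(b *: e1) ord0] = G.@[(b *: e1) ord0].
  have := Feval 0 b 0; rewrite !scale0r add0r addr0 => ->.
  by rewrite expr0n gtn_eqF // mul0r addr0.
rewrite (homog_scale _ _ hF) F1 (homog_scale _ _ xL.1) L0.
by rewrite !mulr0 addr0 eqxx.
Qed.

(** Eisenstein at x: g(0) = 0 because e1 lies on the curve, g_1 is nonzero by [tangent_e0], and l(0)
    is nonzero because L(e1) is. *)
Lemma homology_prime P Q : in_ideal F (P * Q) -> in_ideal F P \/ in_ideal F Q.
Proof.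
have [G [L [xG xL FE]]] := homology_equation.
have [g Eg] := nest_xyform xG; have [l El] := nest_xyform xL.
have Feval a b c := homology_value a b c xG xL FE.
have F0 a b : F.@[(a *: e0 + b *: e1) ord0] = G.@[(a *: e0 + b *: e1) ord0].
  have := Feval a b 0; rewrite scale0r addr0 => ->.
  by rewrite expr0n gtn_eqF // mul0r addr0.
have nF : nest (mpoly_mx F e) = l *: 'X^m + g%:P.
  have nX : nest (mpoly_mx (coord_form i2) e) = 'X.
    rewrite /coord_form mpoly_mx_mul mulmxV // mpoly_mx1 /nest mmapX mmap1U.
    by rewrite /nest_var (tnth_nth 0).
  rewrite FE mpoly_mxD mpoly_mxM mpoly_mxXn nestD nestM nestX nX Eg El.
  by rewrite addrC -mul_polyC mulrC.
have g0 : g`_0 = 0.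
  rewrite -horner_coef0; apply: poly_vanish => b.
  rewrite -[0]polyC0 (horner_nest_xyform _ _ Eg) -F0 scale0r add0r.
  by rewrite (homog_scale _ _ hF) F1 mulr0.
have Le1 := homology_coef_neq0 xG xL FE.
have l0 : l`_0 != 0.
  apply: contraNneq Le1 => l00.
  have := horner_nest_xyform 0 1 El; rewrite scale0r scale1r add0r => <-.
  by rewrite polyC0 horner_coef0 l00 horner0.
have g1 : g`_1 != 0.
  apply: contraNneq tangent_e0 => g10; rewrite -line_poly_coef1.
  suff -> : line_poly e1 e0 F = map_poly (horner_eval 1) g.
    by rewrite coef_map /= /horner_eval g10 horner0.
  apply/eqP; rewrite -subr_eq0; apply/eqP/poly_vanish => t.
  rewrite hornerD hornerN horner_line.
  have := horner_map (horner_eval 1) g t%:P; rewrite /= /horner_eval hornerC => ->.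
  by rewrite (horner_nest_xyform _ _ Eg) -F0 scale1r [t *: e0 + e1]addrC subrr.
(* L has degree d - m: it is a nonzero constant when d = m and a linear form when d = m + 1. *)
have L_regular : regular_mod F L.
  have Ln0 : L != 0 by apply: contraNneq Le1 => ->; rewrite meval0.
  have [hL _] := xL.
  have [dmE|dmE] := eqVneq d m.
    have LC : L = (L@_0)%:MP.
      apply: msize1_polyC; rewrite dmE subnn in hL.
      by rewrite -[X in (_ <= X.+1)%N](dhomog_uniq Ln0 (dhomog_msize hL) hL) leqSpred.
    have c0 : L@_0 != 0 by apply: contraNneq Ln0 => c0; rewrite LC c0 mpolyC0.
    move=> R [S E]; exists ((L@_0)^-1 *: S).
    by rewrite -scalerAl -E {2}LC mul_mpolyC scalerA mulVf // scale1r.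
  apply: (linear_regular _ smF _ Ln0); first exact: leq_trans (ltnW m2) md.
  have dm1 : (d - m = 1)%N.
    have md' : (m < d)%N by rewrite ltn_neqAle eq_sym dmE.
    by apply/eqP; rewrite eqn_leq subn_gt0 md' leq_subLR addn1 dm.
  by rewrite dm1 in hL.
(* Pseudo-division yields L^k R in the ideal (F), in the coordinates of the eigenbasis; L^k is then
   cancelled by regularity. *)
have back R : nest (mpoly_mx F e) %| nest (mpoly_mx R e) -> in_ideal F R.
  move=> FR.
  have [k [q E0]] : exists k q, nest (mpoly_mx L e) ^+ k * nest (mpoly_mx R e) =
      q * nest (mpoly_mx F e).
    move: FR; rewrite Pdiv.Idomain.dvdp_eq => /eqP.
    have -> : lead_coef (nest (mpoly_mx F e)) = l.
      have ln0 : l != 0 by apply: contraNneq l0 => ->; rewrite coef0.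
      rewrite nF lead_coefDl ?lead_coefZ ?lead_coefXn ?mulr1 //.
      by rewrite size_scale // size_polyXn ltnS (leq_trans (size_polyC_leq1 _)).
    by rewrite -mul_polyC rmorphXn /= -El; do 2!eexists; eassumption.
  have [S E1] : exists S, mpoly_mx L e ^+ k * mpoly_mx R e = S * mpoly_mx F e.
    by exists (unnest q); exact: unnest_nest_rel.
  apply: (regular_modX (k := k) L_regular); exists (mpoly_mx S (invmx e)).
  rewrite -[F in RHS](mpoly_mxK _ e_unit) -mpoly_mxM -E1 mpoly_mxM mpoly_mxXn.
  by rewrite !mpoly_mxK.
move=> [S E].
have : nest (mpoly_mx F e) %| nest (mpoly_mx P e) * nest (mpoly_mx Q e).
  by rewrite -nestM -mpoly_mxM E mpoly_mxM nestM dvdp_mull.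
rewrite {1}nF => /(eisenstein_prime m0 l0 g0 g1); rewrite -nF.
by case=> /back ?; [left|right].
Qed.
End Homology.

(** * Pullback of rational functions *)

Section Pullback.
Variable C : numClosedFieldType.
Implicit Types (G H P Q : {mpoly C[3]}) (v w : 'rV[C]_3).
Variables (F : {mpoly C[3]}) (A : 'M[C]_3) (l : C).
Hypotheses (Au : A \in unitmx) (l0 : l != 0) (FA : mpoly_mx F A = l *: F).

Local Notation ff := (function_field F).

Lemma in_idealZ a P : in_ideal F P -> in_ideal F (a *: P).
Proof. by rewrite -mul_mpolyC; exact: in_idealMl. Qed.

Lemma in_ideal_sum (I : Type) (s : seq I) (Q : pred I) (G : I -> {mpoly C[3]}) :
  (forall i, Q i -> in_ideal F (G i)) -> in_ideal F (\sum_(i <- s | Q i) G i).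
Proof.
by move=> QG; elim/big_ind: _ => //; [exact: in_ideal0|exact: in_idealD].
Qed.

Lemma in_ideal_mx P : in_ideal F P -> in_ideal F (mpoly_mx P A).
Proof.
move=> [Q ->]; exists (l *: mpoly_mx Q A).
by rewrite mpoly_mxM FA -scalerAl scalerAr.
Qed.

Lemma regular_mod_mx H : regular_mod F H -> regular_mod F (mpoly_mx H A).
Proof.
move=> rH P [Q E].
have [|S ES] := rH (mpoly_mx P (invmx A)).
  exists (mpoly_mx Q (invmx A) * (l^-1)%:MP).
  have := congr1 (fun R : {mpoly C[3]} => mpoly_mx R (invmx A)) E.
  rewrite !mpoly_mxM mpoly_mxK // => ->.
  rewrite -mulrA; congr (_ * _); rewrite mul_mpolyC.
  rewrite -[in RHS](mpoly_mxK F Au) FA mpoly_mxZ scalerA mulVf // scale1r.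
  by [].
exists (mpoly_mx S A * l%:MP).
rewrite -mulrA mul_mpolyC -FA -mpoly_mxM -ES mpoly_mx_mul mulmxV //.
by rewrite mpoly_mx1.
Qed.

Lemma hfrac_pred_mx G H : hfrac_pred F (G, H) ->
  hfrac_pred F (mpoly_mx G A, mpoly_mx H A).
Proof.
move=> /asboolP[[k /= [hG hH]] rH]; apply: (@hfrac_predP _ _ _ _ _ k).
- exact: dhomog_mpoly_mx.
- exact: dhomog_mpoly_mx.
- exact: regular_mod_mx.
Qed.

Lemma pullbackE G H : hfrac_pred F (G, H) ->
  pullback F A (hratio F G H) = hratio F (mpoly_mx G A) (mpoly_mx H A).
Proof.
move=> v; have [va ea] := repr_hratio v; rewrite /pullback.
apply/eq_hratio; [exact: hfrac_pred_mx..|].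
by rewrite -!mpoly_mxM -mpoly_mxN -mpoly_mxD; exact: in_ideal_mx.
Qed.

Lemma hratioD G H G' H' : hfrac_pred F (G, H) -> hfrac_pred F (G', H') ->
  hratio F G H + hratio F G' H' = hratio F (G * H' + G' * H) (H * H').
Proof. exact: ffaddE. Qed.

Lemma hratioN G H : hfrac_pred F (G, H) -> - hratio F G H = hratio F (- G) H.
Proof. exact: ffoppE. Qed.

Lemma hratioM G H G' H' : hfrac_pred F (G, H) -> hfrac_pred F (G', H') ->
  hratio F G H * hratio F G' H' = hratio F (G * G') (H * H').
Proof. exact: ffmulE. Qed.

Lemma hratio1 : 1 = hratio F 1 1 :> ff.
Proof. by []. Qed.

Lemma hratio0 : 0 = hratio F 0 1 :> ff.
Proof. by []. Qed.

Lemma hfrac_pred_const a : hfrac_pred F (a%:MP, 1).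
Proof.
apply: (@hfrac_predP _ _ _ _ _ 0); rewrite ?dhomog1 //; last exact: regular_mod1.
by rewrite -[a]mulr1 mpolyCM mpolyC1 mul_mpolyC rpredZ ?dhomog1.
Qed.

Lemma const_rmorphism :
  exists c : {rmorphism C -> ff}, forall a, c a = hratio F a%:MP 1.
Proof.
pose f a := hratio F a%:MP 1; have v := hfrac_pred_const.
have zm : zmod_morphism f.
  move=> a b; rewrite /f (hratioN (v b)) (hratioD (v a) (hfrac_predN (v b))).
  by rewrite !mulr1 -mpolyCN -mpolyCD.
have mm : monoid_morphism f.
  split=> [|a b]; first by rewrite /f mpolyC1.
  by rewrite /f (hratioM (v a) (v b)) mulr1 -mpolyCM.
pose za := GRing.isZmodMorphism.Build _ _ f zm.
pose ma := GRing.isMonoidMorphism.Build _ _ f mm.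
pose s : {rmorphism C -> ff} := HB.pack f za ma.
by exists s.
Qed.

Lemma pullback_rmorphism :
  exists s : {rmorphism ff -> ff}, s =1 pullback F A.
Proof.
have zm : zmod_morphism (pullback F A).
  move=> x y; have [G [H [v ->]]] := hratio_surj x.
  have [G' [H' [v' ->]]] := hratio_surj y.
  have [vA v'A] := (hfrac_pred_mx v, hfrac_pred_mx v').
  rewrite (pullbackE v) (pullbackE v') (hratioN v') (hratioN v'A).
  rewrite (hratioD v (hfrac_predN v')) (hratioD vA (hfrac_predN v'A)).
  rewrite (pullbackE (hfrac_predD v (hfrac_predN v'))).
  by rewrite mpoly_mxD !mpoly_mxM mpoly_mxN.
have mm : monoid_morphism (pullback F A).
  split=> [|x y].
    rewrite hratio1 pullbackE; last exact: hfrac1_subproof.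
    by rewrite -mpolyC1 mpoly_mxC.
  have [G [H [v ->]]] := hratio_surj x; have [G' [H' [v' ->]]] := hratio_surj y.
  rewrite (hratioM v v') (pullbackE v) (pullbackE v').
  rewrite (hratioM (hfrac_pred_mx v) (hfrac_pred_mx v')).
  by rewrite (pullbackE (hfrac_predM v v')) !mpoly_mxM.
pose za := GRing.isZmodMorphism.Build _ _ (pullback F A) zm.
pose ma := GRing.isMonoidMorphism.Build _ _ (pullback F A) mm.
pose s : {rmorphism ff -> ff} := HB.pack (pullback F A) za ma.
by exists s.
Qed.

Lemma hratio_scale a G H : a != 0 -> hfrac_pred F (G, H) ->
  hratio F (a *: G) (a *: H) = hratio F G H.
Proof.
move=> a0 /asboolP[[k /= [hG hH]] rH].
apply: hratio_eq; last by rewrite -scalerAl -scalerAr subrr.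
  apply: (@hfrac_predP _ _ _ _ _ k); rewrite ?rpredZ// => P [Q E].
  apply: rH; exists (a^-1 *: Q); rewrite -scalerAl -E -scalerAl scalerA mulVf //.
  by rewrite scale1r.
exact: (@hfrac_predP _ _ _ _ _ k).
Qed.

(** Numerator and denominator have the same degree. This permits normalizing the eigenvalue on the
    axis of a homology to 1. *)
Lemma pullback_scale a phi : a != 0 -> pullback F (a *: A) phi = pullback F A phi.
Proof.
move=> a0; have [G [H [v ->]]] := hratio_surj phi.
have [va _] := repr_hratio v; rewrite /pullback.
have /asboolP[[k /= [hG hH]] _] := va.
rewrite (mpoly_mx_scale _ _ hG) (mpoly_mx_scale _ _ hH) hratio_scale //.
  by rewrite expf_neq0.
exact: hfrac_pred_mx.
Qed.

End Pullback.

(** * Kummer extensions *)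

Section Fourier.
Variables (C : numClosedFieldType) (B : comPzRingType) (c : {rmorphism C -> B}).
Variables (m : nat) (zeta : C).
Hypotheses (m0 : (0 < m)%N) (prim : m.-primitive_root zeta).

Lemma prim_root_neq0 : zeta != 0.
Proof.
apply/eqP => z0; have := prim_expr_order prim.
by rewrite z0 expr0n gtn_eqF // => /eqP; rewrite eq_sym oner_eq0.
Qed.

(** A Lagrange resolvent: when y_j is the j-th iterate at x of an automorphism s with s^m = 1 fixing
    the constants, it is the component of x in the zeta^k-eigenspace of s. *)
Definition fourier (y : nat -> B) k :=
  c m%:R^-1 * \sum_(j < m) c (zeta ^- (k * j)) * y j.

Lemma sum_root_powers j : (j < m)%N ->
  \sum_(k < m) zeta ^- (k * j) = if j == 0%N then m%:R else 0.
Proof.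
move=> jm; have zn0 := prim_root_neq0.
under eq_bigr => k _ do rewrite mulnC exprM -exprVn.
case: eqP => [->|/eqP jn0].
  under eq_bigr => k _ do rewrite expr0 invr1 expr1n.
  by rewrite sumr_const card_ord.
have wn1 : (zeta ^+ j)^-1 - 1 != 0.
  rewrite subr_eq0 invr_eq1 -(prim_order_dvd prim) gtnNdvd // lt0n.
  by [].
apply: (mulfI wn1); rewrite mulr0 -subrX1 exprVn -exprM mulnC exprM.
by rewrite (prim_expr_order prim) expr1n invr1 subrr.
Qed.

Lemma sum_fourier y : \sum_(k < m) fourier y k = y 0%N.
Proof.
rewrite /fourier -mulr_sumr exchange_big /=.
under eq_bigr => j _ do rewrite -mulr_suml -rmorph_sum /= sum_root_powers //.
rewrite (bigD1 (Ordinal m0)) //= big1 => [|j].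
  by rewrite addr0 mulrA -rmorphM mulVf ?pnatr_eq0 -?lt0n // rmorph1 mul1r.
rewrite -val_eqE /= => /negPf ->; by rewrite rmorph0 mul0r.
Qed.

Lemma fourier_shift y k : y m = y 0%N ->
  fourier (fun j => y j.+1) k = c (zeta ^+ k) * fourier y k.
Proof.
have zn0 := prim_root_neq0.
move=> ym; rewrite /fourier mulrCA; congr (_ * _).
pose g j := c (zeta ^+ k) * (c (zeta ^- (k * j)) * y j).
have gE j : c (zeta ^- (k * j)) * y j.+1 = g j.+1.
  rewrite /g mulrA -rmorphM mulnS exprD invfM mulrA mulfV ?mul1r//.
  by rewrite expf_neq0.
under eq_bigr => j _ do rewrite gE.
rewrite mulr_sumr -/(g _).
have gm : g m = g 0%N.
  by rewrite /g ym mulnC exprM (prim_expr_order prim) expr1n muln0.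
exact: (big_ord_shift _ gm).
Qed.

End Fourier.

Section Kummer.
Variables (C : numClosedFieldType) (B : comPzRingType).
Variables (c : {rmorphism C -> B}) (s : {rmorphism B -> B}).
Variables (m : nat) (zeta : C) (t u : B).
Hypotheses (m0 : (0 < m)%N) (prim : m.-primitive_root zeta).
Hypotheses (sc : forall a, s (c a) = c a) (tu : t * u = 1).
Hypotheses (st : s t = c zeta * t) (sm : forall x, iter m s x = x).

(** The k-th resolvent of x is multiplied by zeta^k under s, exactly as t^k is; dividing it by t^k
    gives an invariant coefficient. *)
Lemma kummer_decomposition x : exists b : 'I_m -> B,
  (forall i, s (b i) = b i) /\ x = \sum_i b i * t ^+ i.
Proof.
have zn0 := prim_root_neq0 m0 prim.
pose y j := iter j s x; pose f := fourier c m zeta y.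
have sf k : s (f k) = c (zeta ^+ k) * f k.
  rewrite -fourier_shift //; last exact: sm.
  rewrite /f /fourier rmorphM rmorph_sum sc; congr (_ * _).
  by apply: eq_bigr => j _; rewrite rmorphM sc.
have su : s u = c zeta^-1 * u.
  have : s t * s u = 1 by rewrite -rmorphM tu rmorph1.
  rewrite st => E; rewrite -[LHS]mul1r -tu -[X in X * _]mulr1 -(rmorph1 c).
  by rewrite -(mulVf zn0) rmorphM -[RHS]mulr1 -E; ring.
exists (fun i => f i * u ^+ i); split=> [i|].
  rewrite rmorphM rmorphXn sf su exprMn -rmorphXn mulrACA -rmorphM.
  by rewrite exprVn mulfV ?expf_neq0 // rmorph1 mul1r.
rewrite -[LHS](sum_fourier c m0 prim y); apply: eq_bigr => i _.
by rewrite -/f -mulrA -exprMn [u * t]mulrC tu expr1n mulr1.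
Qed.

Variable K : set B.
Hypothesis KE : forall x, K x <-> s x = x.

Lemma kummer_galois_aut : galois_aut K s.
Proof.
split=> [|x /KE//]; exists (iter m.-1 s) => x.
  by rewrite -iterSr prednK.
by rewrite -iterS prednK.
Qed.

Lemma kummer_galois_ext : is_field B -> galois_ext K.
Proof.
move=> fB; split=> // [|x].
  exists m, (fun i => t ^+ i) => x; have [b [sb ->]] := kummer_decomposition x.
  by exists b; split=> // i; apply/KE.
split=> [fix_x|Kx s' [_ s'K]]; last exact: s'K.
by apply/KE; apply: fix_x; exact: kummer_galois_aut.
Qed.

Lemma kummer_iter k : iter k s t = c (zeta ^+ k) * t.
Proof.
elim: k => [|k IH]; first by rewrite expr0 rmorph1 mul1r.
by rewrite iterS IH rmorphM sc st mulrA -rmorphM -exprSr.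
Qed.

(* An automorphism over K multiplies t by a w with w^m = 1; one of the
   eigenprojections of multiplication by w is nonzero, hence w is a power of
   zeta. *)
Lemma kummer_generates f : is_field B -> s =1 f -> generates_galois_group K f.
Proof.
move=> [n10 fB] sf; exists s; split=> //; first exact: kummer_galois_aut.
move=> s' [_ s'K]; pose w := s' t * u.
have wm : w ^+ m = 1.
  have : s' (t ^+ m) = t ^+ m.
    apply: s'K; apply/KE; rewrite rmorphXn st exprMn -rmorphXn.
    by rewrite (prim_expr_order prim) rmorph1 mul1r.
  by rewrite rmorphXn exprMn => ->; rewrite -exprMn tu expr1n.
pose g := fourier c m zeta (fun j => w ^+ j).
have wg k : w * g k = c (zeta ^+ k) * g k.
  rewrite -fourier_shift ?wm ?expr0 // /g /fourier mulrCA; congr (_ * _).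
  by rewrite mulr_sumr; apply: eq_bigr => j _; rewrite mulrCA exprS.
have [k gk] : exists k, g k <> 0.
  have [//|none] := pselect (exists k, g k <> 0).
  case: n10; rewrite -(expr0 w) -(sum_fourier c m0 prim (fun j => w ^+ j)).
  rewrite big1 // => k _; have [//|gk] := pselect (g k = 0).
  by case: none; exists (k : nat).
have [v gv] := fB _ gk.
have s't : s' t = iter k s t.
  rewrite kummer_iter; have <- : w = c (zeta ^+ k).
    by rewrite -[w]mulr1 -gv mulrA wg -mulrA gv mulr1.
  by rewrite /w -mulrA [u * t]mulrC tu mulr1.
exists k => x; have [b [sb ->]] := kummer_decomposition x.
have -> j : iter j s (\sum_i b i * t ^+ i) = \sum_i b i * (iter j s t) ^+ i.
  elim: j => // j IH; rewrite iterS IH rmorph_sum; apply: eq_bigr => i _.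
  by rewrite rmorphM rmorphXn sb.
rewrite rmorph_sum; apply: eq_bigr => i _.
by rewrite rmorphM rmorphXn s't s'K //; apply/KE.
Qed.

End Kummer.

(** * The projection from the center of a homology *)

Section HomologyGalois.
Variable C : numClosedFieldType.
Implicit Types (G H P Q : {mpoly C[3]}) (v w : 'rV[C]_3).
Variables (d m : nat) (F : {mpoly C[3]}) (A : 'M[C]_3).
Variables (e0 e1 e2 : 'rV[C]_3) (zeta : C).
Hypothesis smF : smooth_plane_curve d F.
Hypothesis fr : free3 e0 e1 e2.
Hypotheses (Ae0 : e0 *m A = e0) (Ae1 : e1 *m A = e1) (Ae2 : e2 *m A = zeta *: e2).
Hypothesis prim : m.-primitive_root zeta.
Hypothesis FA : mpoly_mx F A = F.
Hypotheses (md : (m <= d)%N) (dm : (d <= m.+1)%N) (m2 : (2 < m)%N).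
Hypothesis F1 : F.@[e1 ord0] = 0.

Local Notation x := (coord_form e0 e1 e2 i0).
Local Notation y := (coord_form e0 e1 e2 i1).
Local Notation z := (coord_form e0 e1 e2 i2).
Local Notation proj := (proj_e2 e0 e1 e2).
Local Notation xyform := (xyform e0 e1 e2).
Local Notation ff := (function_field F).

Let hF : F \is d.-homog. Proof. by case: smF. Qed.
Let Fn0 : F != 0. Proof. exact: smooth_neq0 smF. Qed.
Let m0 : (0 < m)%N. Proof. exact: leq_trans m2. Qed.
Let d1 : (1 < d)%N. Proof. exact: leq_trans (ltnW m2) md. Qed.
Let prime_F P Q : in_ideal F (P * Q) -> in_ideal F P \/ in_ideal F Q.
Proof. exact: (homology_prime smF fr Ae0 Ae1 Ae2 prim FA md dm m2 F1). Qed.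

Let regularP H : ~ in_ideal F H -> regular_mod F H.
Proof. by move=> nH P /prime_F[]. Qed.

Let regular_small k H : H \is k.-homog -> H != 0 -> (k < d)%N -> regular_mod F H.
Proof.
move=> hH Hn0 kd; apply: regularP => /(in_ideal_homog_lt hF Fn0 hH kd) H0.
by rewrite H0 eqxx in Hn0.
Qed.

Let Am : A ^+ m = 1%:M.
Proof.
have fru := (free3_unit e0 e1 e2).1 fr.
have Ak k a b c : (a *: e0 + b *: e1 + c *: e2) *m A ^+ k =
    a *: e0 + b *: e1 + (c * zeta ^+ k) *: e2.
  elim: k c => [|k IH] c; first by rewrite !expr0 mulmx1 mulr1.
  rewrite exprSr mulmxA IH (comb_mulA Ae0 Ae1 Ae2).
  by rewrite -mulrA -exprSr.
apply: (can_inj (mulKmx fru)); rewrite mulmx1.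
apply/row_matrixP => i; rewrite !rowE mulmxA.
move: (delta_mx _ _) => u; rewrite mul_mat3 Ak (prim_expr_order prim) mulr1.
by [].
Qed.

Let Au : A \in unitmx.
Proof.
have : A ^+ m \in unitmx by rewrite Am unitmx1.
by rewrite -(prednK m0) exprS unitmx_mul => /andP[].
Qed.

Let FA1 : mpoly_mx F A = 1 *: F. Proof. by rewrite scale1r. Qed.
Let one0 : (1 : C) != 0. Proof. exact: oner_neq0. Qed.

Lemma not_in_ideal1 : ~ in_ideal F 1.
Proof.
move/(in_ideal_homog_lt hF Fn0 (dhomog1 _ _)) => /(_ (ltnW d1)).
by move/eqP; rewrite oner_eq0.
Qed.

Lemma homology_is_field : is_field ff.
Proof.
split.
  rewrite hratio1 hratio0 => /eq_hratio.
  move=> /(_ (hfrac1_subproof F) (hfrac_pred01 F)).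
  by rewrite mulr1 mul0r subr0 => /not_in_ideal1.
move=> phi; have [G [H [v ->]]] := hratio_surj phi => phi0.
have /asboolP[[k /= [hG hH]] rH] := v.
have w : hfrac_pred F (H, G).
  apply: (@hfrac_predP _ _ _ _ _ k) => //; apply: regularP => FG; apply: phi0.
  rewrite hratio0; apply/eq_hratio => //; first exact: hfrac_pred01.
  by rewrite mulr1 mul0r subr0.
exists (hratio F H G); rewrite (hratioM v w) hratio1.
apply: hratio_eq; [exact: hfrac_predM|exact: hfrac1_subproof|].
by rewrite mulr1 mul1r mulrC subrr.
Qed.

Let s_ex := pullback_rmorphism Au one0 FA1.

Lemma mpoly_mx_iterS P j : mpoly_mx (mpoly_mx P (A ^+ j)) A = mpoly_mx P (A ^+ j.+1).
Proof. by rewrite mpoly_mx_mul exprS. Qed.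

Lemma iter_pullback k G H : hfrac_pred F (G, H) ->
  hfrac_pred F (mpoly_mx G (A ^+ k), mpoly_mx H (A ^+ k)) /\
  iter k (pullback F A) (hratio F G H) =
    hratio F (mpoly_mx G (A ^+ k)) (mpoly_mx H (A ^+ k)).
Proof.
move=> v; elim: k => [|k [vk IH]]; first by rewrite !expr0 !mpoly_mx1.
rewrite iterS IH (pullbackE Au one0 FA1 vk).
rewrite -(mpoly_mx_iterS G k) -(mpoly_mx_iterS H k).
by split; [exact: (hfrac_pred_mx Au one0 FA1 vk)|reflexivity].
Qed.

Lemma iter_pullback_id phi : iter m (pullback F A) phi = phi.
Proof.
have [G [H [v ->]]] := hratio_surj phi.
by have [_ ->] := iter_pullback m v; rewrite Am !mpoly_mx1.
Qed.

Lemma dhomog_prod_const k n (R : nat -> {mpoly C[3]}) :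
  (forall j, R j \is k.-homog) -> \prod_(j < n) R j \is (n * k).-homog.
Proof.
move=> hR; elim: n => [|n IH]; first by rewrite big_ord0 dhomog1.
by rewrite big_ord_recr mulSnr; apply: dhomogM.
Qed.

(* Modulo F one has z^m L = - G, which eliminates z from an invariant form at
   the cost of a power of L. *)
Lemma eliminate_z k G L P : xyform d G -> xyform (d - m) L -> F = G + z ^+ m * L ->
  P \is k.-homog -> mpoly_mx P A = P ->
  exists2 P', xyform (k + k * (d - m)) P' & in_ideal F (L ^+ k * P - P').
Proof.
move=> xG xL FE hP PA.
have [s [c [sP PE]]] := invariant_expansion fr Ae0 Ae1 Ae2 prim hP PA.
(* The number of factors z^m in the monomial n; it is at most k, so L^k suffices to turn each of
   them into - G. *)
pose q (n : 'X_{1..3}) := (n i2 %/ m)%N.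
exists (\sum_(n <- s) c n *: (x ^+ n i0 * y ^+ n i1 * (L ^+ (k - q n) * (- G) ^+ q n))).
  apply: xyform_sum => n /sP[nk mn] _; apply: xyformZ.
  have xN : xyform d (- G).
    by case: xG => hG pG; split; rewrite ?rpredN// mpoly_mxN pG.
  have n2 : n i2 = (q n * m)%N by rewrite divnK.
  have qk : (q n <= k)%N.
    by rewrite -nk n2 (leq_trans _ (leq_addl _ _)) // leq_pmulr.
  have -> : (k + k * (d - m) = n i0 + n i1 + ((d - m) * (k - q n) + d * q n))%N.
    move: (subnK qk) (subnK md) nk; rewrite n2.
    move: (k - q n)%N (d - m)%N => r D.
    by move: (q n) => j kE dE nk; rewrite -dE -{1}nk -kE; ring.
  apply: xyformM; first exact: xyform_mono.
  by apply: xyformM; exact: xyformX.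
rewrite PE mulr_sumr -sumrB big_seq; apply: in_ideal_sum => n /sP[nk mn].
rewrite -scalerAr -scalerBr; apply: in_idealZ.
have n2 : n i2 = (m * q n)%N by rewrite mulnC divnK.
have qk : (q n <= k)%N.
  by rewrite -nk n2 (leq_trans _ (leq_addl _ _)) // leq_pmull.
have -> : L ^+ k * (x ^+ n i0 * y ^+ n i1 * z ^+ n i2) -
    x ^+ n i0 * y ^+ n i1 * (L ^+ (k - q n) * (- G) ^+ q n) =
    x ^+ n i0 * y ^+ n i1 * L ^+ (k - q n) *
      ((L * z ^+ m) ^+ q n - (- G) ^+ q n).
  have -> : L ^+ k = L ^+ (k - q n) * L ^+ q n by rewrite -exprD subnK.
  have -> : z ^+ n i2 = (z ^+ m) ^+ q n by rewrite n2 exprM.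
  by rewrite exprMn; ring.
apply: in_idealMl; rewrite subrXX mulrC; apply: in_idealMl.
by exists 1; rewrite mul1r FE opprK addrC [L * _]mulrC.
Qed.

(* The norm of the denominator and the average of the numerator are invariant,
   so an invariant fraction can be freed from z. *)
Lemma invariant_fraction phi : pullback F A phi = phi ->
  exists k P Q, [/\ xyform k P, xyform k Q, regular_mod F Q & phi = hratio F P Q].
Proof.
have [P [Q [v ->]]] := hratio_surj phi => sphi.
have /asboolP[[k /= [hP hQ]] rQ] := v.
pose N := \prod_(j < m) mpoly_mx Q (A ^+ j).
pose P1 := P * \prod_(j < m.-1) mpoly_mx Q (A ^+ j.+1).
have hQj j : mpoly_mx Q (A ^+ j) \is k.-homog by exact: dhomog_mpoly_mx.
have hN : N \is (m * k).-homog.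
  by rewrite /N; apply: (dhomog_prod_const m hQj).
have NE : N = Q * \prod_(j < m.-1) mpoly_mx Q (A ^+ j.+1).
  rewrite /N; case: (m) m0 => // m' _.
  by rewrite big_ord_recl expr0 mpoly_mx1.
have hP1 : P1 \is (m * k).-homog.
  rewrite -(prednK m0) mulSn; apply: dhomogM => //.
  exact: (@dhomog_prod_const k m.-1 (fun j => mpoly_mx Q (A ^+ j.+1))).
have A0 : A ^+ m = A ^+ 0 by rewrite Am expr0.
have NA : mpoly_mx N A = N.
  rewrite /N mpoly_mx_prod (eq_bigr (fun j : 'I_m => mpoly_mx Q (A ^+ j.+1))).
    by apply: (@big_ord_shift _ _ _ m (fun j => mpoly_mx Q (A ^+ j))); rewrite A0.
  by move=> j _; exact: mpoly_mx_iterS.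
have NAj j : mpoly_mx N (A ^+ j) = N.
  elim: j => [|j IH]; first by rewrite expr0 mpoly_mx1.
  by rewrite -(mpoly_mx_iterS N j) IH.
have rN : regular_mod F N.
  rewrite /N; elim/big_ind: _ => [|G H|j _]; first exact: regular_mod1.
    exact: regular_modM.
  by have [/asboolP[_ /=]] := iter_pullback j v.
have vN : hfrac_pred F (P1, N) by exact: (hfrac_predP hP1 hN rN).
have phi1 : hratio F P Q = hratio F P1 N.
  by apply: (hratio_eq v vN); rewrite NE /P1; ring.
pose P2 := m%:R^-1 *: \sum_(j < m) mpoly_mx P1 (A ^+ j).
have hP2 : P2 \is (m * k).-homog.
  by apply: rpredZ; apply: rpred_sum => j _; exact: dhomog_mpoly_mx.
have P2A : mpoly_mx P2 A = P2.
  rewrite /P2 mpoly_mxZ; apply: (congr1 (fun G : {mpoly C[3]} => m%:R^-1 *: G)).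
  rewrite mpoly_mx_sum (eq_bigr (fun j : 'I_m => mpoly_mx P1 (A ^+ j.+1))).
    by apply: (@big_ord_shift _ _ _ m (fun j => mpoly_mx P1 (A ^+ j))); rewrite A0.
  by move=> j _; exact: mpoly_mx_iterS.
have v2 : hfrac_pred F (P2, N) by exact: (hfrac_predP hP2 hN rN).
(* The conjugates of P1 over the invariant denominator N all represent the invariant fraction phi,
   hence so does their average. *)
have phi2 : hratio F P1 N = hratio F P2 N.
  apply/(eq_hratio vN v2).
  have -> : P1 * N - P2 * N =
      - (m%:R^-1 *: \sum_(j < m) (mpoly_mx P1 (A ^+ j) * N - P1 * N)).
    rewrite sumrB sumr_const card_ord scalerBr -scaler_nat scalerA mulVf.
      by rewrite scale1r /P2 -mulr_suml -scalerAl opprB.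
    by rewrite pnatr_eq0 -lt0n.
  apply: in_idealN; apply: in_idealZ; apply: in_ideal_sum => j _.
  have [vj] := iter_pullback j vN; rewrite NAj in vj * => Ej.
  apply/(eq_hratio vj vN); rewrite -Ej -phi1; exact: iter_fix.
have [G [L [xG xL FE]]] := homology_equation smF fr Ae0 Ae1 Ae2 prim FA dm m2.
(* Numerator and denominator have the same degree m k, so both are multiplied by the same power of
   L, which cancels. *)
have [P3 xP3 EP] := eliminate_z xG xL FE hP2 P2A.
have [Q3 xQ3 EQ] := eliminate_z xG xL FE hN NA.
have rL : regular_mod F L.
  apply: (regular_small xL.1); last by rewrite ltn_subrL m0 (ltnW d1).
  have := homology_coef_neq0 smF fr md m2 F1 xG xL FE.
  by apply: contraNneq => ->; rewrite meval0.
have rQ3 : regular_mod F Q3.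
  apply: regularP => iQ3; apply: not_in_ideal1; apply: rN; rewrite mulr1.
  apply: (regular_modX (k := (m * k)%N) rL).
  by rewrite -[_ * N](subrK Q3); apply: in_idealD.
exists (m * k + m * k * (d - m))%N, P3, Q3; split=> //.
have v3 := hfrac_predP xP3.1 xQ3.1 rQ3.
rewrite phi1 phi2; apply/(eq_hratio v2 v3).
have -> : P2 * Q3 - P3 * N = N * (L ^+ (m * k) * P2 - P3) -
    P2 * (L ^+ (m * k) * N - Q3) by ring.
by apply: in_idealD; [|apply: in_idealN]; exact: in_idealMl.
Qed.

Local Notation p := <[e2]>%VS.

Let e2n0 : e2 != 0.
Proof. exact: (free3_neq0 (free3_rot (free3_rot fr))). Qed.

Let pick_e2 : exists2 a, a != 0 & vpick p = a *: e2.
Proof.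
have /vlineP[a ae] := memv_pick p; exists a => //.
have : vpick p != 0 by rewrite vpick0 -dimv_eq0 dim_vline e2n0.
by rewrite ae; apply: contraNneq => ->; rewrite scale0r.
Qed.

(** The projection kills e2, and A is the identity modulo e2; so composing A with the projection
    changes nothing. *)
Lemma proj_field_fixed phi : proj_field F p phi -> pullback F A phi = phi.
Proof.
have [a a0 pE] := pick_e2; move=> [h [k [G1 [G2 [_ h1 h2 r2 ->]]]]].
rewrite pE in r2 *; set pi := center_proj_mx _ _ in r2 *.
have e2pi : e2 *m pi = 0.
  by rewrite center_proj_mxE -scalemxAl mxE scalerA mulrC subrr.
have Api : A *m pi = pi.
  have fru := (free3_unit e0 e1 e2).1 fr.
  apply: (can_inj (mulKmx fru)); apply/row_matrixP => i; rewrite !rowE !mulmxA.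
  move: (delta_mx _ _) => u; rewrite !mul_mat3 (comb_mulA Ae0 Ae1 Ae2) !mulmxDl.
  by rewrite -!(scalemxAl _ e2) e2pi !scaler0.
have v : hfrac_pred F (mpoly_mx G1 pi, mpoly_mx G2 pi).
  by apply: (hfrac_predP (dhomog_mpoly_mx _ h1) (dhomog_mpoly_mx _ h2)).
by rewrite (pullbackE Au one0 FA1 v) !mpoly_mx_mul Api.
Qed.

Lemma fixed_proj_field phi : pullback F A phi = phi -> proj_field F p phi.
Proof.
move=> /invariant_fraction[k [P [Q [[hP pP] [hQ pQ] rQ ->]]]].
have [a a0 pE] := pick_e2.
(* The axis is chosen as target line: with this h the central projection is a multiple of [proj],
   which leaves x and y fixed. *)
pose h : 'cV[C]_3 := invmx (mat3 e0 e1 e2) *m delta_mx i2 ord0.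
have e2h : (e2 *m h) ord0 ord0 = 1.
  have := coord_comb2 fr 0 0 1; rewrite !scale0r !add0r scale1r mpoly_mxE mevalXU => <-.
  by rewrite mulmxA -colE mxE.
have piE : center_proj_mx (vpick p) h = a *: proj.
  rewrite pE /center_proj_mx -scalemxAl mxE e2h mulr1 /proj_e2 -/h.
  by rewrite scalerBr scalemx1 -scalemxAr.
exists h, k, P, Q; split=> //.
- rewrite pE -scalemxAl => /matrixP/(_ ord0 ord0).
  by rewrite mxE e2h mulr1 [RHS]mxE => /eqP; rewrite (negPf a0).
- rewrite piE (mpoly_mx_scale _ _ hQ) pQ => R [S E]; apply: rQ.
  exists (a ^- k *: S); rewrite -scalerAl -E -scalerAl scalerA mulVf ?scale1r //.
  by rewrite expf_neq0.
- rewrite piE (mpoly_mx_scale _ _ hP) (mpoly_mx_scale _ _ hQ) pP pQ.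
  by rewrite hratio_scale ?expf_neq0 //; exact: (hfrac_predP hP hQ rQ).
Qed.

Lemma homology_galois : galois_ext (proj_field F p) /\
  generates_galois_group (proj_field F p) (pullback F A).
Proof.
have [s sE] := s_ex; have [c cE] := const_rmorphism F.
have co1 i : hfrac_pred F (coord_form e0 e1 e2 i, coord_form e0 e1 e2 i).
  apply: (hfrac_predP (coord_homog _ _ _ i) (coord_homog _ _ _ i)).
  exact: (regular_small (coord_homog _ _ _ i) (coord_neq0 fr i) d1).
have co i j : hfrac_pred F (coord_form e0 e1 e2 i, coord_form e0 e1 e2 j).
  apply: (hfrac_predP (coord_homog _ _ _ i) (coord_homog _ _ _ j)).
  exact: (regular_small (coord_homog _ _ _ j) (coord_neq0 fr j) d1).
pose t := hratio F z x; pose u := hratio F x z.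
have sc a : s (c a) = c a.
  rewrite sE cE (pullbackE Au one0 FA1 (hfrac_pred_const F a)) mpoly_mxC.
  by rewrite -mpolyC1 mpoly_mxC.
have tu : t * u = 1.
  rewrite (hratioM (co _ _) (co _ _)) hratio1; apply: hratio_eq.
  - exact: (hfrac_predM (co _ _) (co _ _)).
  - exact: hfrac1_subproof.
  - by rewrite mulr1 mul1r mulrC subrr.
have coordA_ := coordA fr Ae0 Ae1 Ae2.
have st : s t = c zeta * t.
  rewrite sE (pullbackE Au one0 FA1 (co _ _)) !coordA_ /= scale1r cE.
  rewrite (hratioM (hfrac_pred_const F zeta) (co _ _)) mul1r.
  by rewrite mul_mpolyC.
have sm phi : iter m s phi = phi.
  by rewrite -[RHS]iter_pullback_id; apply: eq_iter.
have KE phi : proj_field F p phi <-> s phi = phi.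
  by rewrite sE; split; [exact: proj_field_fixed|exact: fixed_proj_field].
have fF := homology_is_field.
split; first exact: (kummer_galois_ext m0 prim sc tu st sm KE fF).
exact: (kummer_generates m0 prim sc tu st sm KE fF sE).
Qed.

End HomologyGalois.

(** * Eigenvalues and fixed points *)

Section Eigenbasis.
Variable C : numClosedFieldType.
Implicit Types (G H P Q : {mpoly C[3]}) (v w : 'rV[C]_3).
Variables (d : nat) (F : {mpoly C[3]}) (A : 'M[C]_3) (l : C).
Hypothesis smF : smooth_plane_curve d F.
Hypothesis d4 : (3 < d)%N.
Hypotheses (Au : A \in unitmx) (l0 : l != 0) (FA : mpoly_mx F A = l *: F).

Let hF : F \is d.-homog. Proof. by case: smF. Qed.
Let Fn0 : F != 0. Proof. exact: smooth_neq0 smF. Qed.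
Let d0 : (0 < d)%N. Proof. exact: leq_trans d4. Qed.
Let d1 : (1 < d)%N. Proof. exact: leq_trans d4. Qed.

Let FAE v : F.@[(v *m A) ord0] = l * F.@[v ord0].
Proof. by rewrite -mpoly_mxE FA mevalZ. Qed.

Lemma eigen_off v a : v *m A = a *: v -> F.@[v ord0] != 0 -> l = a ^+ d.
Proof.
move=> va Fv; have := FAE v; rewrite va (homog_scale _ _ hF) => /mulIf.
by move=> /(_ Fv).
Qed.

Lemma dir_deriv_scale a v w : dir_deriv F (a *: v) w = a ^+ d.-1 * dir_deriv F v w.
Proof.
rewrite /dir_deriv mulr_sumr; apply: eq_bigr => i _.
by rewrite (homog_scale _ _ (dhomog_mderiv _ hF)) mulrCA.
Qed.

(** Comparison of the coefficients of t in F((v + t w) A) = l F(v + t w). *)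
Lemma eigen_tangent v w a b : v *m A = a *: v -> w *m A = b *: w ->
  dir_deriv F v w != 0 -> l = a ^+ d.-1 * b.
Proof.
move=> va wb Dn0; apply: (mulIf Dn0).
have -> : a ^+ d.-1 * b * dir_deriv F v w = dir_deriv F (a *: v) (b *: w).
  by rewrite dir_derivZ dir_deriv_scale; ring.
rewrite -!line_poly_coef1 -coefZ.
suff -> : l *: line_poly v w F = line_poly (a *: v) (b *: w) F by [].
apply/eqP; rewrite -subr_eq0; apply/eqP/poly_vanish => t.
rewrite hornerD hornerN hornerZ !horner_line -FAE mulmxDl -scalemxAl va wb.
by rewrite !scalerA [t * b]mulrC subrr.
Qed.

Lemma eigen_on v0 v1 v2 a0 a1 a2 : free3 v0 v1 v2 -> v0 *m A = a0 *: v0 ->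
  v1 *m A = a1 *: v1 -> v2 *m A = a2 *: v2 -> F.@[v0 ord0] = 0 ->
  l = a0 ^+ d.-1 * a1 \/ l = a0 ^+ d.-1 * a2.
Proof.
move=> fr e0 e1 e2 F0; have [w] := smooth_dir smF (free3_neq0 fr) F0.
have [x [y [z ->]]] := free3_span w fr.
rewrite !dir_derivD !dir_derivZ (euler_zero hF F0) mulr0 add0r => Dn0.
have [D1|D1] := eqVneq (dir_deriv F v0 v1) 0; last first.
  by left; exact: (eigen_tangent e0 e1).
right; apply: (eigen_tangent e0 e2); apply: contraNneq Dn0 => ->.
by rewrite D1 !mulr0 addr0.
Qed.

Lemma eigenvalue_neq0 v a : v != 0 -> v *m A = a *: v -> a != 0.
Proof.
move=> vn0 va; have := mul_unit_neq0 Au vn0; rewrite va.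
by apply: contraNneq => ->; rewrite scale0r.
Qed.

Lemma eigen_power v a k : v *m A = a *: v -> v *m A ^+ k = a ^+ k *: v.
Proof.
move=> va; elim: k => [|k IH]; first by rewrite !expr0 mulmx1 scale1r.
by rewrite exprSr mulmxA IH -scalemxAl va scalerA -exprSr.
Qed.

Lemma power_scalar v0 v1 v2 a0 a1 a2 k c : free3 v0 v1 v2 ->
  v0 *m A = a0 *: v0 -> v1 *m A = a1 *: v1 -> v2 *m A = a2 *: v2 ->
  (A ^+ k = c%:M) <-> [/\ a0 ^+ k = c, a1 ^+ k = c & a2 ^+ k = c].
Proof.
move=> fr e0 e1 e2; split=> [Ak|[k0 k1 k2]].
  have ev v a : v != 0 -> v *m A = a *: v -> a ^+ k = c.
    move=> vn0 /(@eigen_power _ _ k); rewrite Ak mul_mx_scalar => /eqP.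
    by rewrite eq_sym -subr_eq0 -scalerBl scaler_eq0 (negPf vn0) orbF subr_eq0 => /eqP.
  have fr1 := free3_rot fr; have fr2 := free3_rot fr1.
  by split; [apply: ev e0|apply: ev e1|apply: ev e2]; apply: free3_neq0; eassumption.
have fru := (free3_unit v0 v1 v2).1 fr.
apply: (can_inj (mulKmx fru)); apply/row_matrixP => i; rewrite !rowE !mulmxA.
move: (delta_mx _ _) => u; rewrite !mul_mat3 !mulmxDl -!scalemxAl.
rewrite (eigen_power k e0) (eigen_power k e1) (eigen_power k e2) k0 k1 k2.
by rewrite !mul_mx_scalar.
Qed.

Lemma fixed_pointP v : v != 0 -> F.@[v ord0] = 0 ->
  (exists a, v *m A = a *: v) -> fixed_points F A <[v]>%VS.
Proof.
move=> vn0 Fv [a va]; split; first exact/(zero_locus_line hF vn0).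
by rewrite proj_act_line va vline_scale // (eigenvalue_neq0 vn0 va).
Qed.

Lemma fixed_point_eigen U : fixed_points F A U ->
  exists v a, [/\ v != 0, U = <[v]>%VS, F.@[v ord0] = 0 & v *m A = a *: v].
Proof.
move=> [ZU]; have [v vn0 UE] := dim1_line ZU.1.
rewrite UE proj_act_line => /(vline_inj (mul_unit_neq0 Au vn0))[a _ va].
exists v, a; split=> //; apply/(zero_locus_line hF vn0).
by rewrite -UE.
Qed.

Lemma fixed_point_distinct v0 v1 v2 a0 a1 a2 U : free3 v0 v1 v2 ->
  v0 *m A = a0 *: v0 -> v1 *m A = a1 *: v1 -> v2 *m A = a2 *: v2 ->
  a0 != a1 -> a0 != a2 -> a1 != a2 -> fixed_points F A U ->
  [\/ U = <[v0]>%VS /\ F.@[v0 ord0] = 0, U = <[v1]>%VS /\ F.@[v1 ord0] = 0 |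
      U = <[v2]>%VS /\ F.@[v2 ord0] = 0].
Proof.
move=> fr e0 e1 e2 a01 a02 a12 /fixed_point_eigen[v [a [vn0 -> Fv va]]].
have [x [y [z vE]]] := free3_span v fr.
have [] : [/\ x * (a0 - a) = 0, y * (a1 - a) = 0 & z * (a2 - a) = 0].
  apply: fr; move: va; rewrite vE !mulmxDl -!scalemxAl e0 e1 e2 => /eqP.
  rewrite -subr_eq0 => /eqP <-.
  by apply/rowP => i; rewrite !mxE; ring.
have line w (b : C) : v = b *: w -> <[v]>%VS = <[w]>%VS /\ F.@[w ord0] = 0.
  move=> vw; have bn0 : b != 0.
    by apply: contraNneq vn0 => b0; rewrite vw b0 scale0r.
  split; first by rewrite vw vline_scale.
  apply/eqP; move: Fv; rewrite vw (homog_scale _ _ hF) => /eqP.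
  by rewrite mulf_eq0 expf_eq0 (negPf bn0) andbF.
have zero (x' b : C) : b != a -> x' * (b - a) = 0 -> x' = 0.
  by move=> ba /eqP; rewrite mulf_eq0 subr_eq0 (negPf ba) orbF => /eqP.
have [aE|/eqP n0] := eqVneq a0 a.
  rewrite aE in a01 a02; move=> _ /zero Y /zero Z.
  apply: Or31; apply: (line v0 x); rewrite vE Y 1?eq_sym // Z 1?eq_sym //.
  by rewrite !scale0r !addr0.
have [aE|/eqP n1] := eqVneq a1 a.
  rewrite aE in a01 a12; move=> /zero X _ /zero Z.
  apply: Or32; apply: (line v1 y); rewrite vE X // Z 1?eq_sym //.
  by rewrite !scale0r add0r addr0.
move=> /zero X /zero Y _.
apply: Or33; apply: (line v2 z); rewrite vE X ?Y; try exact/eqP.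
by rewrite !scale0r !add0r.
Qed.

(** Produces linear forms vanishing at w; two of them, sharing the same G, give an element of the
    projection field of w. *)
Lemma pencil_form G H w : G \is 1.-homog -> H \is 1.-homog ->
  exists K, K \is 1.-homog /\
    forall v, K.@[v ord0] = G.@[w ord0] * H.@[v ord0] - H.@[w ord0] * G.@[v ord0].
Proof.
move=> hG hH; exists (G.@[w ord0] *: H - H.@[w ord0] *: G); split.
  by rewrite rpredB // rpredZ.
by move=> v; rewrite mevalB !mevalZ.
Qed.

(* If g belongs to p, then g fixes every quotient of two linear forms vanishing
   at p; in the eigenbasis this makes two eigenvalues equal. *)
Lemma belongs_eigenvalues v0 v1 v2 a0 a1 a2 (p : {vspace 'rV[C]_3}) :
  free3 v0 v1 v2 -> v0 *m A = a0 *: v0 ->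
  v1 *m A = a1 *: v1 -> v2 *m A = a2 *: v2 ->
  (coord_form v0 v1 v2 i0).@[(vpick p) ord0] != 0 -> belongs_to F A p -> a1 = a2.
Proof.
move=> fr e0 e1 e2; set w := vpick p => w0 [s [[_ sK] sE _]].
have [xi [hxi xiE]] := pencil_form w (coord_homog v0 v1 v2 i0) (coord_homog v0 v1 v2 i1).
have [eta [heta etaE]] := pencil_form w (coord_homog v0 v1 v2 i0) (coord_homog v0 v1 v2 i2).
have xiw : xi.@[w ord0] = 0 by rewrite xiE mulrC subrr.
have etaw : eta.@[w ord0] = 0 by rewrite etaE mulrC subrr.
move: xiE etaE w0; set w_0 := (coord_form v0 v1 v2 i0).@[w ord0] => xiE etaE w0.
have valxi b c : xi.@[(0 *: v0 + b *: v1 + c *: v2) ord0] = w_0 * b.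
  by rewrite xiE (coord_comb0 fr) (coord_comb1 fr) mulr0 subr0.
have valeta b c : eta.@[(0 *: v0 + b *: v1 + c *: v2) ord0] = w_0 * c.
  by rewrite etaE (coord_comb0 fr) (coord_comb2 fr) mulr0 subr0.
have etan0 : eta != 0.
  apply: contraNneq w0 => eta0; have := valeta 0 1.
  by rewrite eta0 meval0 mulr1 => <-.
have reta : regular_mod F eta by exact: (linear_regular d1 smF heta etan0).
have v : hfrac_pred F (xi, eta) by exact: (hfrac_predP hxi heta reta).
have [k wk] : exists k, w ord0 k != 0.
  have [//|none] := pselect (exists k, w ord0 k != 0).
  have w_eq0 : w = 0.
    apply/rowP => i; rewrite [RHS]mxE; apply/eqP; apply: contraT => wi.
    by case: none; exists i.
  by move: w0; rewrite /w_0 w_eq0 (homog_eval0 (coord_homog v0 v1 v2 i0)) ?eqxx.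
pose h : 'cV[C]_3 := delta_mx k ord0.
have wh : (w *m h) ord0 ord0 = w ord0 k by rewrite -colE mxE.
have proj H : H \is 1.-homog -> H.@[w ord0] = 0 ->
    mpoly_mx H (center_proj_mx w h) = w ord0 k *: H.
  move=> hH Hw; apply: mpoly_ext => u; rewrite mpoly_mxE center_proj_mxE mevalZ.
  rewrite -scaleNr homog1_add // !(homog_scale _ _ hH) Hw mulr0 addr0 expr1.
  by rewrite wh.
have Kphi : proj_field F p (hratio F xi eta).
  exists h, 1%N, xi, eta; rewrite /= -/w (proj xi hxi xiw) (proj eta heta etaw); split=> //.
  - by move=> /matrixP/(_ ord0 ord0); rewrite wh [RHS]mxE => /eqP; rewrite (negPf wk).
  - move=> R [S E]; apply: reta; exists ((w ord0 k)^-1 *: S).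
    by rewrite -scalerAl -E -scalerAl scalerA mulVf ?scale1r.
  - by rewrite hratio_scale.
have := sK _ Kphi; rewrite sE (pullbackE Au l0 FA v).
move/(eq_hratio (hfrac_pred_mx Au l0 FA v) v) => II.
(* Degree 2 is less than d, so this form is 0; its value at v1 + v2 is a nonzero multiple of a1 -
   a2. *)
have h2 : mpoly_mx xi A * eta - xi * mpoly_mx eta A \is 2.-homog.
  by rewrite rpredB //; apply: (@dhomogM _ _ _ 1 _ 1) => //; exact: dhomog_mpoly_mx.
have := in_ideal_homog_lt hF Fn0 h2 (ltnW d4) II.
move/(congr1 (fun G : {mpoly C[3]} => G.@[(0 *: v0 + 1 *: v1 + 1 *: v2) ord0])).
rewrite meval0 mevalB !mevalM !mpoly_mxE.
have -> : (0 *: v0 + 1 *: v1 + 1 *: v2) *m A = 0 *: v0 + a1 *: v1 + a2 *: v2.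
  by rewrite !scale0r !scale1r !add0r mulmxDl e1 e2.
rewrite !valxi !valeta !mulr1 => /eqP.
rewrite (_ : _ - _ = w_0 * w_0 * (a1 - a2)); last by ring.
rewrite !mulf_eq0 (negPf w0) /= subr_eq0.
by move/eqP.
Qed.

End Eigenbasis.

(** * Classification *)

Local Open Scope classical_set_scope.

Lemma card2_of_pair (T : eqType) (S : set T) (u v : T) : u != v ->
  S u -> S v -> (forall w, S w -> w = u \/ w = v) -> (S #= `I_2)%card.
Proof.
move=> uv Su Sv Suv; apply/card_set_bijP.
exists (fun w => if w == u then 0%N else 1%N); split.
- by move=> w _ /=; case: ifP.
- move=> w w'; rewrite !inE => /Suv[]-> /Suv[]->;
    rewrite ?eqxx ?[v == u]eq_sym ?(negPf uv) //.
- case=> [|[|//]] _; [exists u|exists v] => //; first by rewrite eqxx.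
  by rewrite eq_sym (negPf uv).
Qed.

Lemma card2_no_triple (T : eqType) (S : set T) (u v w : T) :
  u != v -> u != w -> v != w -> S u -> S v -> S w -> ~ (S #= `I_2)%card.
Proof.
move=> uv uw vw Su Sv Sw /card_set_bijP[f [fS fI _]].
have inj x y : S x -> S y -> x != y -> f x <> f y.
  by move=> Sx Sy xy fxy; case/eqP: xy; apply: fI; rewrite ?inE.
have := inj _ _ Su Sv uv; have := inj _ _ Su Sw uw; have := inj _ _ Sv Sw vw.
have := fS _ Su; have := fS _ Sv; have := fS _ Sw => /=.
by case: (f u) => [|[|]] //; case: (f v) => [|[|]] //; case: (f w) => [|[|]].
Qed.

Section Classification.
Variable C : numClosedFieldType.
Variables (d : nat) (F : {mpoly C[3]}) (A : 'M[C]_3) (l : C).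
Hypothesis smF : smooth_plane_curve d F.
Hypothesis d4 : (3 < d)%N.
Hypotheses (Au : A \in unitmx) (l0 : l != 0) (FA : mpoly_mx F A = l *: F).

Let hF : F \is d.-homog. Proof. by case: smF. Qed.
Let d0 : (0 < d)%N. Proof. exact: leq_trans d4. Qed.
Let d1 : (1 < d)%N. Proof. exact: leq_trans d4. Qed.

Let dP (a : C) : a ^+ d = a ^+ d.-1 * a.
Proof. by rewrite -exprSr prednK. Qed.

Section Distinct.
Variable c : C.

Lemma vline_neq (v0 v1 v2 : 'rV[C]_3) : free3 v0 v1 v2 -> <[v0]>%VS != <[v1]>%VS.
Proof.
move=> fr; apply/eqP => /(vline_inj (free3_neq0 fr))[a _ v01].
have [] := fr 1 (- a) 0; last by move/eqP; rewrite oner_eq0.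
by rewrite scale1r scaleNr scale0r addr0 {1}v01 subrr.
Qed.

(** Since every a_i^(d-1) equals c, the smoothness relations become l = c a_i when v_i is off the
    curve and l = c a_j with j different from i when it is on it. The a_i being distinct, l = c a_j
    for exactly one j; that v_j is off the curve and the other two are on it. *)
Lemma distinct_fixed_two (v0 v1 v2 : 'rV[C]_3) a0 a1 a2 : free3 v0 v1 v2 ->
  v0 *m A = a0 *: v0 -> v1 *m A = a1 *: v1 -> v2 *m A = a2 *: v2 ->
  a0 != a1 -> a0 != a2 -> a1 != a2 ->
  a0 ^+ d.-1 = c -> a1 ^+ d.-1 = c -> a2 ^+ d.-1 = c ->
  (fixed_points F A #= `I_2)%card.
Proof.
(* The case in which l belongs to the first eigenvalue; the others follow by rotating the basis. *)
have aux (u0 u1 u2 : 'rV[C]_3) b0 b1 b2 : free3 u0 u1 u2 ->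
  u0 *m A = b0 *: u0 -> u1 *m A = b1 *: u1 -> u2 *m A = b2 *: u2 ->
  b0 != b1 -> b0 != b2 -> b1 != b2 ->
  b0 ^+ d.-1 = c -> b1 ^+ d.-1 = c -> b2 ^+ d.-1 = c -> l = c * b0 ->
  (fixed_points F A #= `I_2)%card.
  move=> fr e0 e1 e2 b01 b02 b12 c0 c1 c2 lE.
  have cn0 : c != 0 by apply: contraNneq l0 => c00; rewrite lE c00 mul0r.
  have cI b b' : l = c * b -> l = c * b' -> b = b'.
    by move=> -> /(mulfI cn0).
  have F1 : F.@[u1 ord0] = 0.
    apply/eqP; apply: contraT => /(eigen_off smF FA e1); rewrite dP c1 => /cI.
    by move=> /(_ _ lE) bE; rewrite bE eqxx in b01.
  have F2 : F.@[u2 ord0] = 0.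
    apply/eqP; apply: contraT => /(eigen_off smF FA e2); rewrite dP c2 => /cI.
    by move=> /(_ _ lE) bE; rewrite bE eqxx in b02.
  have F0 : F.@[u0 ord0] != 0.
    apply/eqP => /(eigen_on smF FA fr e0 e1 e2); rewrite c0.
    case=> /cI/(_ lE) bE; [rewrite bE eqxx in b01|rewrite bE eqxx in b02] => //.
  have fr1 := free3_rot fr; have fr2 := free3_rot fr1.
  have un1 := free3_neq0 fr1; have un2 := free3_neq0 fr2.
  apply: (card2_of_pair (vline_neq fr1)).
  - by apply: (fixed_pointP smF Au) => //; exists b1.
  - by apply: (fixed_pointP smF Au) => //; exists b2.
  - move=> U /(fixed_point_distinct smF Au fr e0 e1 e2 b01 b02 b12).
    by case=> -[-> F_]; [rewrite F_ eqxx in F0|left|right].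
move=> fr e0 e1 e2 a01 a02 a12 c0 c1 c2.
have fr1 := free3_rot fr; have fr2 := free3_rot fr1.
have a10 : a1 != a0 by rewrite eq_sym.
have a20 : a2 != a0 by rewrite eq_sym.
have a21 : a2 != a1 by rewrite eq_sym.
have [F0|F0] := eqVneq (F.@[v0 ord0]) 0; last first.
  have := eigen_off smF FA e0 F0; rewrite dP c0 => lE.
  exact: (aux _ _ _ _ _ _ fr e0 e1 e2 a01 a02 a12 c0 c1 c2 lE).
have := eigen_on smF FA fr e0 e1 e2 F0; rewrite c0 => -[] lE.
  exact: (aux _ _ _ _ _ _ fr1 e1 e2 e0 a12 a10 a20 c1 c2 c0 lE).
exact: (aux _ _ _ _ _ _ fr2 e2 e0 e1 a20 a21 a01 c2 c0 c1 lE).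
Qed.

(** Put r = l / c. A basis vector off the curve forces r = 1; one on the curve makes r a_i another
    eigenvalue. If r = 1, none is on the curve. Otherwise all three are, multiplication by r
    permutes the eigenvalues in a 3-cycle, the cubes of the a_i agree and A^3 is scalar, which is
    excluded. *)
Lemma distinct_fixed_none (v0 v1 v2 : 'rV[C]_3) a0 a1 a2 : free3 v0 v1 v2 ->
  v0 *m A = a0 *: v0 -> v1 *m A = a1 *: v1 -> v2 *m A = a2 *: v2 ->
  a0 != a1 -> a0 != a2 -> a1 != a2 ->
  a0 ^+ d = c -> a1 ^+ d = c -> a2 ^+ d = c ->
  (forall b, A ^+ 3 <> b%:M) -> fixed_points F A = set0.
Proof.
move=> fr e0 e1 e2 a01 a02 a12 c0 c1 c2 A3.
apply/seteqP; split=> [U FU|//]; suff : False by [].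
have fr1 := free3_rot fr; have fr2 := free3_rot fr1.
have n0 := eigenvalue_neq0 Au (free3_neq0 fr) e0.
have n1 := eigenvalue_neq0 Au (free3_neq0 fr1) e1.
have n2 := eigenvalue_neq0 Au (free3_neq0 fr2) e2.
have cn0 : c != 0 by rewrite -c0 expf_neq0.
pose r := l / c.
have on b b' : b != 0 -> b ^+ d = c -> l = b ^+ d.-1 * b' -> b' = r * b.
  move=> bn0 bc lE; rewrite /r lE -bc dP invfM mulrA mulrAC mulfK // mulrAC.
  by rewrite mulfV ?mul1r // expf_neq0.
have off (u : 'rV[C]_3) b : u *m A = b *: u -> b ^+ d = c -> F.@[u ord0] != 0 -> r = 1.
  by move=> ub bc /(eigen_off smF FA ub) lE; rewrite /r lE bc mulfV.
have o0 : F.@[v0 ord0] = 0 -> a1 = r * a0 \/ a2 = r * a0.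
  by move=> /(eigen_on smF FA fr e0 e1 e2)[/on|/on] E; [left|right]; exact: E.
have o1 : F.@[v1 ord0] = 0 -> a2 = r * a1 \/ a0 = r * a1.
  by move=> /(eigen_on smF FA fr1 e1 e2 e0)[/on|/on] E; [left|right]; exact: E.
have o2 : F.@[v2 ord0] = 0 -> a0 = r * a2 \/ a1 = r * a2.
  by move=> /(eigen_on smF FA fr2 e2 e0 e1)[/on|/on] E; [left|right]; exact: E.
have rn1 : r != 1.
  apply/eqP => r1; rewrite r1 !mul1r in o0 o1 o2.
  case: (fixed_point_distinct smF Au fr e0 e1 e2 a01 a02 a12 FU) => -[_].
  - by case/o0 => E; [rewrite E eqxx in a01|rewrite E eqxx in a02].
  - by case/o1 => E; [rewrite E eqxx in a12|rewrite E eqxx in a01].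
  - by case/o2 => E; [rewrite E eqxx in a02|rewrite E eqxx in a12].
have on_all (u : 'rV[C]_3) b : u *m A = b *: u -> b ^+ d = c -> F.@[u ord0] = 0.
  move=> ub bc; apply/eqP; apply: contraT => /(off _ _ ub bc) r1.
  by rewrite r1 eqxx in rn1.
have rn0 : r != 0 by rewrite mulf_neq0 ?invr_eq0.
have rI x y z : x = r * y -> x = r * z -> y = z by move=> -> /(mulfI rn0).
have cycle b0 b1 b2 : b0 != 0 -> b1 = r * b0 -> b2 = r * b1 -> b0 = r * b2 ->
    b1 ^+ 3 = b0 ^+ 3 /\ b2 ^+ 3 = b0 ^+ 3.
  move=> bn0 b1E b2E b0E; have r3 : r ^+ 3 = 1.
    apply: (mulIf bn0); rewrite mul1r [RHS]b0E b2E b1E; ring.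
  split; first by rewrite -[RHS]mul1r -r3 b1E; ring.
  by rewrite -[RHS]mul1r -[1]mul1r -r3 b2E b1E; ring.
have three b : a0 ^+ 3 = b -> a1 ^+ 3 = b -> a2 ^+ 3 = b -> False.
  by move=> E0 E1 E2; apply: (A3 b); apply/(power_scalar 3 b fr e0 e1 e2).
have [o0'|o0'] := o0 (on_all _ _ e0 c0); have [o1'|o1'] := o1 (on_all _ _ e1 c1);
  have [o2'|o2'] := o2 (on_all _ _ e2 c2).
- by have [E1 E2] := cycle _ _ _ n0 o0' o1' o2'; exact: (three (a0 ^+ 3)).
- by rewrite (rI _ _ _ o0' o2') eqxx in a02.
- by rewrite (rI _ _ _ o1' o2') eqxx in a12.
- by rewrite (rI _ _ _ o0' o2') eqxx in a02.
- by rewrite (rI _ _ _ o0' o1') eqxx in a01.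
- by rewrite (rI _ _ _ o0' o1') eqxx in a01.
- by rewrite (rI _ _ _ o1' o2') eqxx in a12.
- by have [E1 E2] := cycle _ _ _ n0 o0' o2' o1'; exact: (three (a0 ^+ 3)).
Qed.

End Distinct.

(** The homology case of both parts, n being d - 1 or d. The basis of the axis is replaced by one
    with e1 on the curve; the tangent condition and the value of l are returned for locating the
    center and counting fixed points. *)
Lemma homology_galois_point n c (v0 v1 v2 : 'rV[C]_3) a b : free3 v0 v1 v2 ->
  v0 *m A = a *: v0 -> v1 *m A = a *: v1 -> v2 *m A = b *: v2 ->
  (2 < n)%N -> (n <= d)%N -> (d <= n.+1)%N ->
  A ^+ n = c%:M -> (forall k e, (0 < k < n)%N -> A ^+ k <> e%:M) ->
  exists e0 e1, [/\ free3 e0 e1 v2 /\ e0 *m A = a *: e0, e1 *m A = a *: e1,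
    F.@[e1 ord0] = 0 /\ dir_deriv F e1 e0 != 0, l = a ^+ d &
    galois_point F <[v2]>%VS /\ belongs_to F A <[v2]>%VS].
Proof.
move=> fr ev0 ev1 ev2 n2 nd dn An Ak; have n0 : (0 < n)%N by exact: leq_trans n2.
have fr2 := free3_rot (free3_rot fr).
have an0 := eigenvalue_neq0 Au (free3_neq0 fr) ev0.
have [an1 _ bn] := (power_scalar n c fr ev0 ev1 ev2).1 An.
pose zeta := b / a.
(* A smaller exponent with zeta^i = 1 would make A^i scalar. *)
have prim : n.-primitive_root zeta.
  rewrite /primitive_root_of_unity n0; apply/forallP => i; rewrite unity_rootE.
  rewrite exprMn exprVn; have [->|ni] := eqVneq i.+1 n.
    by rewrite bn an1 mulfV ?eqxx // -an1 expf_neq0.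
  apply/eqP/negP => /eqP bi.
  have bi' : b ^+ i.+1 = a ^+ i.+1.
    by rewrite -[RHS]mul1r -bi mulfVK // expf_neq0.
  case: (Ak i.+1 (a ^+ i.+1)); first by rewrite /= ltn_neqAle ni ltn_ord.
  exact/(power_scalar _ _ fr ev0 ev1 ev2).
have comb_eig x y : (x *: v0 + y *: v1) *m A = a *: (x *: v0 + y *: v1).
  by rewrite mulmxDl -!scalemxAl ev0 ev1 scalerDr !scalerA ![a * _]mulrC.
have lE : l = a ^+ d.
  have [x [y xy]] := smooth_line_nonzero d1 smF fr.
  exact: (eigen_off smF FA (comb_eig x y) xy).
have [x [y [xy F1]]] := homog_binary_zero v0 v1 d0 hF.
set e1 := x *: v0 + y *: v1 in F1.
have ee1 : e1 *m A = a *: e1 by exact: comb_eig.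
have [e0 fr' ee0] : exists2 e0, free3 e0 e1 v2 & e0 *m A = a *: e0.
  have [yn0|yn0] := eqVneq y 0.
    exists v1 => // r s t E; rewrite yn0 eqxx orbF in xy.
    have [|sx -> ->] := fr (s * x) r t.
      by rewrite -E /e1 yn0 scale0r addr0 scalerA [r *: _ + _]addrC.
    by split=> //; apply/eqP; move/eqP: sx; rewrite mulf_eq0 (negPf xy) orbF.
  exists v0 => // r s t E.
  have [|rx sy ->] := fr (r + s * x) (s * y) t.
    by rewrite -E /e1 scalerDr !scalerA scalerDl addrA.
  have s0 : s = 0 by apply/eqP; move/eqP: sy; rewrite mulf_eq0 (negPf yn0) orbF.
  by move: rx; rewrite s0 mul0r addr0.
(* This representative of g fixes the axis vectorwise and leaves F invariant, because l = a^d. *)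
pose A1 := a^-1 *: A.
have [A1e0 A1e1 A1v2] : [/\ e0 *m A1 = e0, e1 *m A1 = e1 & v2 *m A1 = zeta *: v2].
  by rewrite -!scalemxAr ee0 ee1 ev2 !scalerA mulVf // !scale1r mulrC.
have FA1 : mpoly_mx F A1 = F.
  rewrite (mpoly_mx_scale _ _ hF) FA scalerA lE exprVn mulVf ?scale1r //.
  by rewrite expf_neq0.
have D0 := tangent_e0 smF fr' A1e0 A1e1 A1v2 prim FA1 dn n2 F1.
have [gal [s [gs sE gen]]] := homology_galois smF fr' A1e0 A1e1 A1v2 prim FA1 nd dn n2 F1.
exists e0, e1; split=> //; split.
  by split=> //; rewrite dim_vline (free3_neq0 fr2).
exists s; split; [exact: gs| |exact: gen].
have ai0 : a^-1 != 0 by rewrite invr_eq0.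
by move=> phi; rewrite sE; exact: (pullback_scale Au l0 FA phi ai0).
Qed.

End Classification.

Section GaloisPoints.
Variable C : numClosedFieldType.
Variables (d : nat) (F : {mpoly C[3]}) (A : 'M[C]_3).
Hypothesis d4 : (3 < d)%N.
Hypothesis smF : smooth_plane_curve d F.
Hypothesis AF : linear_automorphism F A.

Let hF : F \is d.-homog. Proof. by case: smF. Qed.
Let d0 : (0 < d)%N. Proof. exact: leq_trans d4. Qed.
Let Au : A \in unitmx. Proof. by case: AF. Qed.

Lemma has_order_scalar n : has_order F A n -> exists c, A ^+ n = c%:M /\
  forall k e, (0 < k < n)%N -> A ^+ k <> e%:M.
Proof.
move=> [n0 tr ntr]; have d2 : (2 < d)%N by exact: ltnW.
have [c An] := (trivial_power_scalar n d2 smF Au).1 tr.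
exists c; split=> // k e kn Ak; apply: (ntr k kn).
by apply/(trivial_power_scalar k d2 smF Au); exists e.
Qed.

(* Up to reordering an eigenbasis, g either has three distinct eigenvalues or is
   a homology with center v2 and axis spanned by v0 and v1. *)
Lemma eigenvalue_dichotomy n c : (1 < n)%N -> A ^+ n = c%:M ->
  (forall k e, (0 < k < n)%N -> A ^+ k <> e%:M) ->
  exists v0 v1 v2 a0 a1 a2, [/\ free3 v0 v1 v2, v0 *m A = a0 *: v0,
    v1 *m A = a1 *: v1, v2 *m A = a2 *: v2 &
    [/\ a0 != a1, a0 != a2 & a1 != a2] \/ (a0 = a1 /\ a1 != a2)].
Proof.
move=> n1 An Ak; have n0 := ltnW n1.
have [v0 [v1 [v2 [a0 [a1 [a2 [fr e0 e1 e2]]]]]]] := finite_order_diagonal n0 Au An.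
have fr1 := free3_rot fr; have fr2 := free3_rot fr1.
have nscal : ~ (a0 = a1 /\ a1 = a2).
  move=> [a01 a12]; case: (Ak 1%N a0); rewrite ?n1 //.
  by apply/(power_scalar 1 a0 fr e0 e1 e2); rewrite !expr1 -a12 -a01.
have [a01|a01] := eqVneq a0 a1.
  exists v0, v1, v2, a0, a1, a2; split=> //; right; split=> //.
  by apply/eqP => a12; case: nscal.
have [a12|a12] := eqVneq a1 a2.
  exists v1, v2, v0, a1, a2, a0; split=> //; right; split=> //.
  by rewrite -a12 eq_sym.
have [a02|a02] := eqVneq a0 a2.
  exists v2, v0, v1, a2, a0, a1; split=> //; right; split=> //.
by exists v0, v1, v2, a0, a1, a2; split=> //; left.
Qed.

(** Some coordinate of p in the eigenbasis is nonzero; [belongs_eigenvalues] then equates the other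
    two eigenvalues. *)
Lemma distinct_not_belongs (v0 v1 v2 : 'rV[C]_3) a0 a1 a2 p : free3 v0 v1 v2 ->
  v0 *m A = a0 *: v0 -> v1 *m A = a1 *: v1 -> v2 *m A = a2 *: v2 ->
  a0 != a1 -> a0 != a2 -> a1 != a2 -> \dim p = 1%N -> ~ belongs_to F A p.
Proof.
move=> fr e0 e1 e2 a01 a02 a12 dp bel.
have [l l0 FA] := linear_automorphism_semiinvariant d0 smF AF.
have fr1 := free3_rot fr; have fr2 := free3_rot fr1.
have wn0 : vpick p != 0.
  by rewrite vpick0; apply: contra_eq_neq dp => ->; rewrite dimv0.
have [x [y [z wE]]] := free3_span (vpick p) fr.
have [x0|xn0] := eqVneq x 0; last first.
  case/eqP: a12; apply: (belongs_eigenvalues smF d4 Au l0 FA fr e0 e1 e2 _ bel).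
  by rewrite wE (coord_comb0 fr).
have [y0|yn0] := eqVneq y 0; last first.
  case/eqP: a02; apply/esym.
  apply: (belongs_eigenvalues smF d4 Au l0 FA fr1 e1 e2 e0 _ bel).
  by rewrite wE -addrA addrC (coord_comb0 fr1).
case/eqP: a01; apply: (belongs_eigenvalues smF d4 Au l0 FA fr2 e2 e0 e1 _ bel).
rewrite wE addrC addrA (coord_comb0 fr2).
by apply: contraNneq wn0 => z0; rewrite wE x0 y0 z0 !scale0r !addr0.
Qed.

(** For a homology both sides hold. The center lies on the curve, since otherwise l = c a2, whereas
    l = c a0. It is fixed, and so are the points of the curve on the axis, of which there are at
    least two. *)
Lemma fixed_points_inner_galois : has_order F A (d - 1)%N ->
  (~ (fixed_points F A #= `I_2)%card <->
   exists p, inner_galois_point F p /\ belongs_to F A p).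
Proof.
have [l l0 FA] := linear_automorphism_semiinvariant d0 smF AF.
rewrite subn1 => /has_order_scalar[c [An Ak]].
have d'2 : (2 < d.-1)%N by rewrite -ltnS prednK.
have [v0 [v1 [v2 [a0 [a1 [a2 [fr e0 e1 e2]]]]]]] := eigenvalue_dichotomy (ltnW d'2) An Ak.
have [k0 k1 k2] := (power_scalar _ _ fr e0 e1 e2).1 An.
have fr2 := free3_rot (free3_rot fr).
case=> [[a01 a02 a12]|[a01 a12]].
  split=> [[]|[p [[[dp _] _]]]]; last first.
    by move/(distinct_not_belongs fr e0 e1 e2 a01 a02 a12 dp).
  exact: (distinct_fixed_two smF d4 Au l0 FA fr e0 e1 e2 a01 a02 a12 k0 k1 k2).
rewrite -{}a01 in e1 k1 a12.
have [|u0 [u1 [[fru ue0] ue1 [F1 D0] lE [gal bel]]]] :=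
  homology_galois_point smF d4 Au l0 FA fr e0 e1 e2 d'2 (leq_pred d) _ An Ak.
  by rewrite prednK.
have dE a : a ^+ d = a ^+ d.-1 * a by rewrite -exprSr prednK.
have cn0 : c != 0.
  rewrite -k0 expf_neq0 //; exact: (eigenvalue_neq0 Au (free3_neq0 fr) e0).
have F2 : F.@[v2 ord0] = 0.
  apply/eqP; apply: contraT => /(eigen_off smF FA e2); rewrite lE !dE k0 k2.
  by move/(mulfI cn0) => a02; rewrite a02 eqxx in a12.
have Z2 : zero_locus F <[v2]>%VS by apply/(zero_locus_line hF (free3_neq0 fr2)).
split=> [_|_]; first by exists <[v2]>%VS.
have fru2 := free3_rot (free3_rot fru).
have fix2 : fixed_points F A <[v2]>%VS.
  by apply: (fixed_pointP smF Au (free3_neq0 fr2) F2); exists a2.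
have fix1 : fixed_points F A <[u1]>%VS.
  by apply: (fixed_pointP smF Au (free3_neq0 (free3_rot fru)) F1); exists a0.
have third x y : x != 0 -> F.@[(x *: u0 + y *: u1) ord0] = 0 ->
    ~ (fixed_points F A #= `I_2)%card.
  move=> xn0 F3; set u := x *: u0 + y *: u1.
  have fr' : free3 u u1 v2.
    move=> r s t E; have [|rx ry ->] := fru (r * x) (r * y + s) t.
      by rewrite -E /u scalerDr !scalerA scalerDl addrA.
    have r0 : r = 0 by apply/eqP; move/eqP: rx; rewrite mulf_eq0 (negPf xn0) orbF.
    by move: ry; rewrite r0 mul0r add0r.
  have fr'2 := free3_rot (free3_rot fr').
  apply: (card2_no_triple (vline_neq fr') _ (vline_neq (free3_rot fr')) _ fix1 fix2).
    by rewrite eq_sym (vline_neq fr'2).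
  apply: (fixed_pointP smF Au (free3_neq0 fr') F3); exists a0.
  by rewrite /u mulmxDl -!scalemxAl ue0 ue1 scalerDr !scalerA ![a0 * _]mulrC.
have [F0|F0] := eqVneq (F.@[u0 ord0]) 0.
  by apply: (third 1 0 (oner_neq0 _)); rewrite scale1r scale0r addr0.
(* On the axis F has degree d in t, and t = 0 is a root, corresponding to u1, which is simple by
   [D0]; the cofactor g therefore has a nonzero root, a second point. *)
have [sf _] := size_line_poly_off u1 hF F0.
pose g := drop_poly 1 (line_poly u1 u0 F).
have fE : line_poly u1 u0 F = g * 'X.
  apply/polyP => i; rewrite coefMX; case: i => [|i] /=.
    by rewrite line_poly_coef0.
  by rewrite coef_drop_poly addn1.
have /closed_rootP[t gt] : size g != 1%N.
  by rewrite size_drop_poly sf subn1 /= gtn_eqF // (leq_trans _ d4).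
have tn0 : t != 0.
  apply: contraNneq D0 => t0; rewrite -line_poly_coef1 fE coefMX /=.
  by move: gt; rewrite t0 /root horner_coef0.
apply: (third t 1 tn0); rewrite scale1r addrC -horner_line fE hornerM.
by rewrite (eqP gt) mul0r.
Qed.

(** For a homology both sides hold: u1 is a fixed point on the axis, and the center is off the
    curve. *)
Lemma fixed_points_outer_galois : has_order F A d ->
  (fixed_points F A <> set0 <->
   exists p, outer_galois_point F p /\ belongs_to F A p).
Proof.
have [l l0 FA] := linear_automorphism_semiinvariant d0 smF AF.
move=> /has_order_scalar[c [An Ak]]; have d2 : (2 < d)%N by exact: ltnW.
have [v0 [v1 [v2 [a0 [a1 [a2 [fr e0 e1 e2]]]]]]] := eigenvalue_dichotomy (ltnW d2) An Ak.
have [k0 k1 k2] := (power_scalar _ _ fr e0 e1 e2).1 An.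
have fr2 := free3_rot (free3_rot fr).
case=> [[a01 a02 a12]|[a01 a12]].
  split=> [[]|[p [[[dp _] _]]]]; last first.
    by move/(distinct_not_belongs fr e0 e1 e2 a01 a02 a12 dp).
  apply: (distinct_fixed_none smF d4 Au l0 FA fr e0 e1 e2 a01 a02 a12 k0 k1 k2).
  by move=> b; apply: Ak; rewrite d4.
rewrite -{}a01 in e1 k1 a12.
have [u0 [u1 [[fru ue0] ue1 [F1 D0] lE [gal bel]]]] :=
  homology_galois_point smF d4 Au l0 FA fr e0 e1 e2 d2 (leqnn d) (leqnSn d) An Ak.
have dE a : a ^+ d = a ^+ d.-1 * a by rewrite -exprSr prednK.
(* A center on the curve would give l = a2^(d-1) a0, while l = a0^d = c = a2^d, so a0 = a2. *)
have Z2 : ~ zero_locus F <[v2]>%VS.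
  move/(zero_locus_line hF (free3_neq0 fr2)) => F2.
  have l2 : l = a2 ^+ d.-1 * a0.
    by case: (eigen_on smF FA fr2 e2 e0 e1 F2).
  have a2n0 := eigenvalue_neq0 Au (free3_neq0 fr2) e2.
  have := l2; rewrite lE k0 -k2 dE => /mulfI E.
  by move: a12; rewrite E ?eqxx // expf_neq0.
split=> [_|_]; first by exists <[v2]>%VS.
move=> fix0; suff : fixed_points F A <[u1]>%VS by rewrite fix0.
by apply: (fixed_pointP smF Au (free3_neq0 (free3_rot fru)) F1); exists a0.
Qed.

End GaloisPoints.

Theorem theorem1p7 (R : realType) (d : nat) (F : {mpoly R[i][3]})
    (A : 'M[R[i]]_3) :
  (4 <= d)%N ->
  smooth_plane_curve d F ->
  linear_automorphism F A ->
  (has_order F A (d - 1)%N ->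
    (~ (fixed_points F A #= `I_2)%card <->
     exists p : {vspace 'rV[R[i]]_3},
       inner_galois_point F p /\ belongs_to F A p)) /\
  (has_order F A d ->
    ((fixed_points F A <> set0)%classic <->
     exists p : {vspace 'rV[R[i]]_3},
       outer_galois_point F p /\ belongs_to F A p)).
Proof.
move=> d4 smF AF.
by split; [exact: fixed_points_inner_galois d4 smF AF|exact: fixed_points_outer_galois d4 smF AF].
Qed.
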